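(* For every integer $n\ge 4$, the compact simple Lie group $\mathrm{Sp}(n)$ admits at least $2\left[\frac{n-1}{3}\right]$ non-naturally reductive left-invariant Einstein metrics.
   Context: $\mathrm{Sp}(n)$ is the compact symplectic group, i.e. the group of $n\times n$ quaternionic matrices $A$ with $A^*A=I$. The symbol $[x]$ denotes the integer part (floor) of $x$. A left-invariant Riemannian metric on a Lie group $G$ is identified with an inner product on its Lie algebra $\mathfrak g$. A Riemannian metric $g$ is Einstein if its Ricci tensor $r$ satisfies $r=\lambda g$ for some constant $\lambda\in\mathbb R$. Naturally reductive left-invariant metrics: let $G$ be a compact simple Lie group with Lie algebra $\mathfrak g$, and let $B$ be the negative of the Killing form of $\mathfrak g$. A left-invariant metric $\langle\cdot,\cdot\rangle$ on $G$ is naturally reductive if there is a closed subgroup $K$ of $G$ such that it is naturally reductive as a homogeneous metric with respect to the action $(g,k)\cdot y=gyk^{-1}$ of $G\times K$ on $G$. By a theorem of D'Atri and Ziller, this is equivalent to the existence of a closed subgroup $K$ of $G$, with Lie algebra $\mathfrak k=\mathfrak k_0\oplus\mathfrak k_1\oplus\cdots\oplus\mathfrak k_p$ ($\mathfrak k_0$ the center of $\mathfrak k$, and $\mathfrak k_1,\dots,\mathfrak k_p$ the simple ideals of $\mathfrak k$) and $B$-orthogonal complement $\mathfrak m$ in $\mathfrak g$, such that $$\langle\cdot,\cdot\rangle=u_0\,b|_{\mathfrak k_0}+u_1B|_{\mathfrak k_1}+\cdots+u_pB|_{\mathfrak k_p}+xB|_{\mathfrak m}$$ for some inner product $b$ on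 $\mathfrak k_0$ and some positive reals $u_0,\dots,u_p,x$. A left-invariant metric is non-naturally reductive if it is not naturally reductive. *)

(* Defs.v *)
From HB Require Import structures.
From mathcomp Require Import all_boot all_order all_algebra.
From mathcomp Require Import all_classical all_reals all_analysis.
From mathcomp Require Import ring.

Set Implicit Arguments.
Unset Strict Implicit.
Unset Printing Implicit Defensive.

Import Order.TTheory GRing.Theory Num.Theory.
Import numFieldNormedType.Exports.

Local Open Scope classical_set_scope.
Local Open Scope ring_scope.

(** * Left-invariant Riemannian metrics

    A left-invariant metric is identified with an inner product [ip] on the
    Lie algebra [g], with bracket [br]; connection and curvature are computed
    on left-invariant vector fields, for which the functions <Y, Z> are
    constant. *)

Section LeftInvariant.
Variables (R : realType) (g : vectType R) (br : g -> g -> g).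
Implicit Types (ip : g -> g -> R) (nabla : g -> g -> g).

Definition inner_product ip : Prop :=
  [/\ forall (a : R) X Y Z, ip (a *: X + Y) Z = a * ip X Z + ip Y Z,
      forall X Y, ip X Y = ip Y X &
      forall X, X != 0 -> 0 < ip X X].

(* Torsion-freeness and metric compatibility; by Koszul's formula they
   determine nabla, and bilinearity follows. *)
Definition levi_civita ip nabla : Prop :=
  (forall X Y, nabla X Y - nabla Y X = br X Y) /\
  (forall X Y Z, ip (nabla X Y) Z + ip Y (nabla X Z) = 0).

Definition curvature nabla (X Y Z : g) : g :=
  nabla X (nabla Y Z) - nabla Y (nabla X Z) - nabla (br X Y) Z.

Definition endo_trace (f : g -> g) : R :=
  \sum_(i < \dim (@fullv R g))
     coord (vbasis (@fullv R g)) i (f (vbasis (@fullv R g))`_i).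

Definition ricci nabla (Y Z : g) : R :=
  endo_trace (fun X => curvature nabla X Y Z).

Definition einstein ip : Prop :=
  exists nabla, levi_civita ip nabla /\
  exists lambda : R, forall Y Z, ricci nabla Y Z = lambda * ip Y Z.

(* On a compact connected simple Lie group, two left-invariant metrics are
   isometric up to a constant factor exactly when they are related in this way
   (Ochiai-Takahashi).  Without this identification, rescaling and conjugating
   one metric would produce infinitely many. *)
Definition equivalent_metrics ip1 ip2 : Prop :=
  exists (f : {linear g -> g}) (c : R),
    [/\ bijective f,
        forall X Y, f (br X Y) = br (f X) (f Y),
        0 < c &
        forall X Y, ip2 (f X) (f Y) = c * ip1 X Y].

End LeftInvariant.

(** * Quaternionic matrices and Sp(n)

    The quadruple (A0, A1, A2, A3) of real matrices stands for the
    quaternionic matrix A0 + A1 i + A2 j + A3 k; the real vector space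
    structure and the topology are those of the product type. *)

Section Quaternionic.
Variables (R : realType) (n : nat).

Definition qmx : Type := ('M[R]_n * 'M[R]_n * 'M[R]_n * 'M[R]_n)%type.

Implicit Types A B : qmx.

Definition re A : 'M[R]_n := A.1.1.1.
Definition im1 A : 'M[R]_n := A.1.1.2.
Definition im2 A : 'M[R]_n := A.1.2.
Definition im3 A : 'M[R]_n := A.2.

Definition qmul A B : qmx :=
  (re A *m re B - im1 A *m im1 B - im2 A *m im2 B - im3 A *m im3 B,
   re A *m im1 B + im1 A *m re B + im2 A *m im3 B - im3 A *m im2 B,
   re A *m im2 B - im1 A *m im3 B + im2 A *m re B + im3 A *m im1 B,
   re A *m im3 B + im1 A *m im2 B - im2 A *m im1 B + im3 A *m re B).

Definition qid : qmx := (1%:M, 0, 0, 0).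

(* Conjugate transpose. *)
Definition qadj A : qmx := ((re A)^T, - (im1 A)^T, - (im2 A)^T, - (im3 A)^T).

Definition Sp : set qmx := [set A | qmul (qadj A) A = qid].

(* The inverse of A in Sp is qadj A. *)
Definition closed_subgroup (K : set qmx) : Prop :=
  [/\ K `<=` Sp, K qid,
      forall A B, K A -> K B -> K (qmul A B),
      forall A, K A -> K (qadj A) &
      closed K].

Definition qherm_part A : qmx := A + qadj A.

Lemma qherm_part_is_linear : linear qherm_part.
Proof.
move=> a [[[A0 A1] A2] A3] [[[B0 B1] B2] B3].
congr (_, _, _, _) => /=; apply/matrixP => i j; rewrite !mxE;
  rewrite /GRing.scale /=; ring.
Qed.

HB.instance Definition _ :=
  GRing.isLinear.Build R qmx qmx _ qherm_part qherm_part_is_linear.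

(* Lie algebra of Sp(n): the skew-Hermitian quaternionic matrices. *)
Definition sp_space : {vspace qmx} := lker (linfun qherm_part).

Definition sp : vectType R := subvs_of sp_space.

Lemma sp_spaceE A : (A \in sp_space) = (qadj A == - A).
Proof. by rewrite memv_ker lfunE /= /qherm_part addrC addr_eq0. Qed.

Fact mxDE (M N : 'M[R]_n) i j : (M + N) i j = M i j + N i j.
Proof. by rewrite mxE. Qed.
Fact mxNE (M : 'M[R]_n) i j : (- M) i j = - M i j.
Proof. by rewrite mxE. Qed.

Lemma qmulA : associative qmul.
Proof.
move=> [[[A0 A1] A2] A3] [[[B0 B1] B2] B3] [[[C0 C1] C2] C3].
rewrite /qmul /re /im1 /im2 /im3 /=; congr (_, _, _, _);
  rewrite !(mulmxDl, mulmxDr, mulmxBl, mulmxBr, mulNmx, mulmxN) !mulmxA;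
  apply/matrixP => i j; rewrite !(mxDE, mxNE); ring.
Qed.

Lemma qmulNr A B : qmul A (- B) = - qmul A B.
Proof.
case: A B => [[[A0 A1] A2] A3] [[[B0 B1] B2] B3].
rewrite /qmul /re /im1 /im2 /im3 /=; congr (_, _, _, _);
  rewrite !(mulmxN, mulNmx, opprK);
  apply/matrixP => i j; rewrite !(mxDE, mxNE); ring.
Qed.

Lemma qmulNl A B : qmul (- A) B = - qmul A B.
Proof.
case: A B => [[[A0 A1] A2] A3] [[[B0 B1] B2] B3].
rewrite /qmul /re /im1 /im2 /im3 /=; congr (_, _, _, _);
  rewrite !(mulmxN, mulNmx, opprK);
  apply/matrixP => i j; rewrite !(mxDE, mxNE); ring.
Qed.

Lemma qadjM A B : qadj (qmul A B) = qmul (qadj B) (qadj A).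
Proof.
case: A B => [[[A0 A1] A2] A3] [[[B0 B1] B2] B3].
rewrite /qmul /qadj /re /im1 /im2 /im3 /=; congr (_, _, _, _);
  rewrite !raddfD ?raddfN /= !trmx_mul !(mulmxN, mulNmx);
  apply/matrixP => i j; rewrite !(mxDE, mxNE); ring.
Qed.

Lemma qadjB : {morph qadj : A B / A - B}.
Proof.
move=> [[[A0 A1] A2] A3] [[[B0 B1] B2] B3].
congr (_, _, _, _) => /=; apply/matrixP => i j; rewrite !mxE; ring.
Qed.

Lemma qadjK : involutive qadj.
Proof.
move=> [[[A0 A1] A2] A3].
by rewrite /qadj /re /im1 /im2 /im3 /= !raddfN /= !trmxK !opprK.
Qed.

(* vsproj only repackages: see vsval_sp_br and vsval_sp_Ad. *)
Definition sp_br (X Y : sp) : sp :=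
  vsproj sp_space (qmul (vsval X) (vsval Y) - qmul (vsval Y) (vsval X)).

Lemma sp_adj (X : sp) : qadj (vsval X) = - vsval X.
Proof. by apply/eqP; rewrite -sp_spaceE subvsP. Qed.

Lemma vsval_sp_br (X Y : sp) :
  vsval (sp_br X Y) = qmul (vsval X) (vsval Y) - qmul (vsval Y) (vsval X).
Proof.
apply: vsprojK; rewrite sp_spaceE qadjB !qadjM !sp_adj !qmulNl !qmulNr.
by rewrite !opprK opprB.
Qed.

Definition sp_Ad (A : qmx) (X : sp) : sp :=
  vsproj sp_space (qmul (qmul A (vsval X)) (qadj A)).

Lemma vsval_sp_Ad (A : qmx) (X : sp) :
  vsval (sp_Ad A X) = qmul (qmul A (vsval X)) (qadj A).
Proof.
apply: vsprojK; rewrite sp_spaceE !qadjM qadjK sp_adj qmulNl qmulNr.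
by rewrite qmulA.
Qed.

(* Initial velocities of the one-parameter subgroups of K. *)
Definition lie_alg (K : set qmx) : set sp :=
  [set X : sp | exists phi : R -> qmx,
     [/\ forall s t, phi (s + t) = qmul (phi s) (phi t),
         forall t, K (phi t) &
         (fun t : R => t^-1 *: (phi t - qid) : qmx) @ 0^' -->
           (vsval X : qmx)]].

(* Differential at the identity of the orbit map (h, k) |-> h k^-1 of the
   action (h, k) . y = h y k^-1 of Sp(n) x K on Sp(n). *)
Definition orbit_diff (u : sp * sp) : sp := u.1 - u.2.

Definition pair_br (u v : sp * sp) : sp * sp := (sp_br u.1 v.1, sp_br u.2 v.2).
Definition pair_Ad (A : qmx) (u : sp * sp) : sp * sp :=
  (sp_Ad A u.1, sp_Ad A u.2).

(* The left-invariant metric ip is invariant under Sp(n) x K iff it is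
   Ad(K)-invariant; the isotropy group at the identity is the diagonal of K.
   The last three items ask for a reductive decomposition
     sp(n) + k = diag(k) + p,   Ad(K) p = p,
   with <[u, v]_p, w> + <v, [u, w]_p> = 0 on p, where p carries the inner
   product transported by orbit_diff.  Since orbit_diff vanishes on diag(k),
   the projections onto p do not appear. *)
Definition naturally_reductive_wrt (K : set qmx) (ip : sp -> sp -> R) : Prop :=
  (forall A X Y, K A -> ip (sp_Ad A X) (sp_Ad A Y) = ip X Y) /\
  exists p : {vspace (sp * sp)%type},
    [/\ forall u, u \in p -> lie_alg K u.2,
        forall X Y, lie_alg K Y ->
          exists! Z, lie_alg K Z /\ (X - Z, Y - Z) \in p,
        forall A u, K A -> u \in p -> pair_Ad A u \in p &
        forall u v w, u \in p -> v \in p -> w \in p ->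
          ip (orbit_diff (pair_br u v)) (orbit_diff w) +
          ip (orbit_diff v) (orbit_diff (pair_br u w)) = 0].

Definition naturally_reductive (ip : sp -> sp -> R) : Prop :=
  exists K, closed_subgroup K /\ naturally_reductive_wrt K ip.

End Quaternionic.

(* Main.v *)
Require Import Defs.
From HB Require Import structures.
From mathcomp Require Import all_boot all_order all_algebra.
From mathcomp Require Import all_classical all_reals all_analysis.
From mathcomp Require Import ring lra zify.

Set Implicit Arguments.
Unset Strict Implicit.
Unset Printing Implicit Defensive.

Import Order.TTheory GRing.Theory Num.Theory.
Import numFieldNormedType.Exports.

Local Open Scope classical_set_scope.
Local Open Scope ring_scope.

(** Write a skew-Hermitian matrix by its quaternionic entries.  Every symmetric
    positive array lam gives the metric <X, Y> = sum_pq lam_pq Re(X_pq^* Y_pq),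
    whose Ricci form is again diagonal in the entries, with an explicit rational
    coefficient [ric].  For blocks of sizes k, k, l = n - 2k with k < l, take lam
    equal to a on the first two diagonal blocks, b between them, 1 between them
    and the third block, and d on the third block.  After discarding the
    factor a - b, the Einstein equations express a and d through b and leave one
    equation F(b) = 0, where F < 0 at b = 1 (this is where k < l enters) and
    F > 0 near 0 and near infinity; hence there is one solution on each side
    of 1.

    If the metric were naturally reductive, then for every Y there would be Z
    with ad Z skew and [Y - Z, lam Y] = 0.  Since b differs from a and 1,
    such a Z is block diagonal, and a Y with entries in the (1, 2) and (2, 3)
    blocks forces b = 1.

    An equivalence of two metrics carries skew elements to skew elements, hence
    intertwines the projections onto the block diagonal matrices; comparing
    traces gives k.  It also preserves the Killing form, hence the
    eigenvalues of the metric on the off-diagonal blocks, which gives b. *)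

(** * Traces of endomorphisms *)

Section Trace.
Variables (R : realType) (g : vectType R).

(* The [e j] need not be linearly independent. *)
Lemma endo_trace_frame (J : finType) (f : g -> g) (psi : J -> g -> R)
    (e : J -> g) :
  (forall j, scalar (psi j)) ->
  (forall X, f X = \sum_j psi j X *: e j) ->
  endo_trace f = \sum_j psi j (e j).
Proof.
move=> psi_lin fE; rewrite /endo_trace.
set b := vbasis _.
transitivity (\sum_j \sum_(i < \dim (@fullv R g))
    coord b i (e j) * psi j b`_i).
  rewrite exchange_big; apply: eq_bigr => i _ /=.
  rewrite fE linear_sum; apply: eq_bigr => j _.
  by rewrite linearZ /= mulrC.
apply: eq_bigr => j _.
pose H := GRing.isLinear.Build R g R *%R (psi j) (psi_lin j).
pose p : {linear g -> R | *%R} := HB.pack (psi j) H.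
rewrite -[psi j]/(p : g -> R) [in RHS](coord_vbasis (memvf (e j))).
by rewrite linear_sum; apply: eq_bigr => i _; rewrite linearZ.
Qed.

Lemma coord_vbasisf (X : g) :
  X = \sum_(i < \dim (@fullv R g))
        coord (vbasis fullv) i X *: (vbasis (@fullv R g))`_i.
Proof. exact: coord_vbasis (memvf X). Qed.

Lemma endo_traceD (f1 f2 : g -> g) :
  endo_trace (fun X => f1 X + f2 X) = endo_trace f1 + endo_trace f2.
Proof.
rewrite /endo_trace -big_split; apply: eq_bigr => i _.
by rewrite linearD.
Qed.

Lemma endo_traceN (f : g -> g) :
  endo_trace (fun X => - f X) = - endo_trace f.
Proof.
by rewrite /endo_trace -sumrN; apply: eq_bigr => i _; rewrite linearN.
Qed.

(** Expanding [f2 X] in the basis shows that [f1 \o f2] has the frame [f1 b_i] with functionals the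
    coordinates of [f2 X]. The frame formula then returns the coordinates of [f2 (f1 b_i)], the
    diagonal of the other composite. *)
Lemma endo_traceC (f1 f2 : {linear g -> g}) :
  endo_trace (f1 \o f2) = endo_trace (f2 \o f1).
Proof.
rewrite (@endo_trace_frame _ _ (fun i X => coord (vbasis fullv) i (f2 X))
  (fun i => f1 (vbasis (@fullv R g))`_i)) //.
- by move=> i a X Y; rewrite !linearP.
- move=> X /=; rewrite {1}[f2 X]coord_vbasisf linear_sum.
  by apply: eq_bigr => i _; rewrite linearZ.
Qed.

(** The frame formula is applied to [g2] with the transported basis [f b_i] and the i-th coordinate
    of [g1 (fi X)]. *)
Lemma endo_trace_conj (f : {linear g -> g}) (g1 g2 : {linear g -> g}) :
  bijective f -> (forall X, g2 (f X) = f (g1 X)) ->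
  endo_trace g1 = endo_trace g2.
Proof.
case=> fi fK fiK gf.
have fi_lin : linear fi by move=> a X Y; apply: (can_inj fK); rewrite linearP !fiK.
rewrite [RHS](@endo_trace_frame _ _
  (fun i X => coord (vbasis fullv) i (g1 (fi X)))
  (fun i => f (vbasis (@fullv R g))`_i)) //.
- by apply: eq_bigr => i _; rewrite fK.
- by move=> i a X Y; rewrite fi_lin !linearP.
- move=> X; rewrite -{1}[X]fiK gf {1}[g1 _]coord_vbasisf linear_sum.
  by apply: eq_bigr => i _; rewrite linearZ.
Qed.

End Trace.

(** * The Levi-Civita connection and the Ricci form *)

Section BracketGeometry.
Variables (R : realType) (g : vectType R) (br : g -> g -> g).
Hypothesis brC : forall X Y, br X Y = - br Y X.

(* With [A_Y X := nabla X Y], torsion-freeness turns the curvature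
   [X |-> R(X, Y) Z] into [A_(nabla Y Z) - A_Z A_Y] plus the commutator of [A_Z]
   and [nabla Y]. *)
Lemma ricci_trace (nabla : g -> g -> g) (Y Z : g) :
  (forall V, linear (nabla^~ V)) -> (forall U, linear (nabla U)) ->
  (forall U V, nabla U V - nabla V U = br U V) ->
  ricci br nabla Y Z = endo_trace (nabla^~ (nabla Y Z)) -
    endo_trace (fun X => nabla (nabla X Y) Z).
Proof.
move=> nabla_linl nabla_linr torsion_free.
pose AZ : {linear g -> g} :=
  HB.pack (nabla^~ Z) (GRing.isLinear.Build R g g *:%R _ (nabla_linl Z)).
pose NY : {linear g -> g} :=
  HB.pack (nabla Y) (GRing.isLinear.Build R g g *:%R _ (nabla_linr Y)).
rewrite /ricci /curvature.
have -> : (fun X => nabla X (nabla Y Z) - nabla Y (nabla X Z) -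
    nabla (br X Y) Z) = (fun X => (nabla X (nabla Y Z) + - (NY \o AZ) X) +
    ((AZ \o NY) X + - nabla (nabla X Y) Z)).
  apply/funext => X /=; rewrite -torsion_free.
  have -> : nabla (nabla X Y - nabla Y X) Z =
     nabla (nabla X Y) Z - nabla (nabla Y X) Z by exact: (linearB AZ).
  by rewrite opprB.
rewrite !endo_traceD !endo_traceN (endo_traceC AZ NY) -addrA.
by rewrite (addrA (- _)) addNr add0r.
Qed.

Variable (B : g -> g -> R) (L Li : {linear g -> g}).
Hypothesis B_linl : forall Y, scalar (B^~ Y).
Hypothesis BC : forall X Y, B X Y = B Y X.
Hypothesis B_inv : forall X Y Z, B (br X Y) Z = - B Y (br X Z).
Hypothesis L_self : forall X Y, B (L X) Y = B X (L Y).
Hypothesis LiK : cancel Li L.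

(* Koszul's formula for the inner product [B (L X) Y], with [B] ad-invariant. *)
Definition koszul (X Y : g) : g :=
  2^-1 *: (br X Y + Li (br X (L Y) - br (L X) Y)).

Let BDl X Y Z : B (X + Y) Z = B X Z + B Y Z.
Proof. by have := B_linl Z 1 X Y; rewrite scale1r mul1r. Qed.
Let BZl a X Z : B (a *: X) Z = a * B X Z.
Proof.
have B0 : B 0 Z = 0.
  by apply: (addrI (B 0 Z)); rewrite -BDl !addr0.
by have := B_linl Z a X 0; rewrite addr0 B0 addr0.
Qed.
Let BBl X Y Z : B (X - Y) Z = B X Z - B Y Z.
Proof. by rewrite BDl -scaleN1r BZl mulN1r. Qed.

(** Antisymmetry of [br] makes the [Li] term of [koszul] symmetric in X and Y, so the torsion sees
    only the bracket. For compatibility, [B_inv] and [L_self] turn both inner products into values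
    of B on brackets, which cancel in pairs. *)
Lemma levi_civita_koszul :
  levi_civita br (fun X Y => B (L X) Y) koszul.
Proof.
have scaleD1 (X : g) : 2^-1 *: X + 2^-1 *: X = X.
  rewrite -scalerDl -[RHS]scale1r; congr (_ *: _); lra.
split=> [X Y|X Y Z].
  rewrite /koszul -scalerBr [br Y X]brC [br Y (L X)]brC [br (L Y) X]brC.
  rewrite opprK -[in RHS](scaleD1 (br X Y)) -scalerDr; congr (_ *: _).
  by rewrite [- br (L X) Y + _]addrC opprD opprK addrACA subrr addr0.
have koszulE U V : B (L (koszul X U)) V =
    2^-1 * (B (br X U) (L V) + (B (br X (L U)) V - B (br (L X) U) V)).
  by rewrite /koszul linearZ linearD /= LiK BZl BDl BBl L_self.
rewrite koszulE !B_inv [B (L Y) (koszul _ _)]L_self [B Y (L _)]BC koszulE.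
rewrite [B (br X Z) _]BC [B (br X (L Z)) _]BC [B (br (L X) Z) _]BC.
by lra.
Qed.

End BracketGeometry.

(** * Quaternions *)

Section Quaternions.
Variable R : realType.

(** A separate record, since the product type of four copies of [R] already has the componentwise
    ring structure. *)
Record quat : Type := Quat { q0 : R; q1 : R; q2 : R; q3 : R }.

Definition quat_to_tuple (x : quat) := (q0 x, q1 x, q2 x, q3 x).
Definition quat_of_tuple (t : R * R * R * R) :=
  let: (a0, a1, a2, a3) := t in Quat a0 a1 a2 a3.
Lemma quat_to_tupleK : cancel quat_to_tuple quat_of_tuple.
Proof. by case. Qed.

HB.instance Definition _ := Equality.copy quat (can_type quat_to_tupleK).
HB.instance Definition _ := Choice.copy quat (can_type quat_to_tupleK).

Implicit Types x y z : quat.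

Definition quat_zero := Quat 0 0 0 0.
Definition quat_opp x := Quat (- q0 x) (- q1 x) (- q2 x) (- q3 x).
Definition quat_add x y :=
  Quat (q0 x + q0 y) (q1 x + q1 y) (q2 x + q2 y) (q3 x + q3 y).

Lemma quat_addA : associative quat_add.
Proof. by move=> [????] [????] [????]; congr Quat; exact: addrA. Qed.

Lemma quat_addC : commutative quat_add.
Proof. by move=> [????] [????]; congr Quat; exact: addrC. Qed.

Lemma quat_add0 : left_id quat_zero quat_add.
Proof. by move=> [????]; congr Quat; exact: add0r. Qed.

Lemma quat_addN : left_inverse quat_zero quat_opp quat_add.
Proof. by move=> [????]; congr Quat; exact: addNr. Qed.

HB.instance Definition _ :=
  GRing.isZmodule.Build quat quat_addA quat_addC quat_add0 quat_addN.

Definition quat_scale (a : R) x := Quat (a * q0 x) (a * q1 x) (a * q2 x) (a * q3 x).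

Lemma quat_scaleA a b x : quat_scale a (quat_scale b x) = quat_scale (a * b) x.
Proof. by case: x => *; congr Quat; exact: mulrA. Qed.

Lemma quat_scale1 : left_id 1 quat_scale.
Proof. by move=> [????]; congr Quat; exact: mul1r. Qed.

Lemma quat_scaleDr : right_distributive quat_scale +%R.
Proof. by move=> a [????] [????]; congr Quat; exact: mulrDr. Qed.

Lemma quat_scaleDl x : {morph quat_scale^~ x : a b / a + b}.
Proof. by move=> a b; case: x => *; congr Quat; exact: mulrDl. Qed.

HB.instance Definition _ := GRing.Zmodule_isLmodule.Build R quat
  quat_scaleA quat_scale1 quat_scaleDr quat_scaleDl.

Definition quat_mul x y : quat :=
  let: Quat a0 a1 a2 a3 := x in let: Quat b0 b1 b2 b3 := y in
  Quat (a0 * b0 - a1 * b1 - a2 * b2 - a3 * b3)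
    (a0 * b1 + a1 * b0 + a2 * b3 - a3 * b2)
    (a0 * b2 - a1 * b3 + a2 * b0 + a3 * b1)
    (a0 * b3 + a1 * b2 - a2 * b1 + a3 * b0).

Definition quat_one : quat := Quat 1 0 0 0.

Lemma quat_mulA : associative quat_mul.
Proof.
move=> [a0 a1 a2 a3] [b0 b1 b2 b3] [c0 c1 c2 c3].
by congr Quat; ring.
Qed.

Lemma quat_mul1l : left_id quat_one quat_mul.
Proof. by move=> [a0 a1 a2 a3]; congr Quat; ring. Qed.

Lemma quat_mul1r : right_id quat_one quat_mul.
Proof. by move=> [a0 a1 a2 a3]; congr Quat; ring. Qed.

Lemma quat_mulDl : left_distributive quat_mul +%R.
Proof.
move=> [a0 a1 a2 a3] [b0 b1 b2 b3] [c0 c1 c2 c3].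
by congr Quat => /=; ring.
Qed.

Lemma quat_mulDr : right_distributive quat_mul +%R.
Proof.
move=> [a0 a1 a2 a3] [b0 b1 b2 b3] [c0 c1 c2 c3].
by congr Quat => /=; ring.
Qed.

Lemma quat_one_neq0 : quat_one != 0.
Proof. by apply/eqP => -[] /eqP; rewrite oner_eq0. Qed.

HB.instance Definition _ := GRing.Zmodule_isNzRing.Build quat
  quat_mulA quat_mul1l quat_mul1r quat_mulDl quat_mulDr quat_one_neq0.

Lemma quat_mulE a0 a1 a2 a3 b0 b1 b2 b3 :
  Quat a0 a1 a2 a3 * Quat b0 b1 b2 b3 =
  Quat (a0 * b0 - a1 * b1 - a2 * b2 - a3 * b3)
    (a0 * b1 + a1 * b0 + a2 * b3 - a3 * b2)
    (a0 * b2 - a1 * b3 + a2 * b0 + a3 * b1)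
    (a0 * b3 + a1 * b2 - a2 * b1 + a3 * b0).
Proof. by []. Qed.

Lemma quat_scaleAl (a : R) x y : a *: (x * y) = (a *: x) * y.
Proof.
move: x y => [a0 a1 a2 a3] [b0 b1 b2 b3].
by congr Quat; rewrite /GRing.scale /=; ring.
Qed.

HB.instance Definition _ := GRing.Lmodule_isLalgebra.Build R quat quat_scaleAl.

Lemma quat_scaleAr (a : R) x y : a *: (x * y) = x * (a *: y).
Proof.
move: x y => [a0 a1 a2 a3] [b0 b1 b2 b3].
by congr Quat; rewrite /GRing.scale /=; ring.
Qed.

HB.instance Definition _ := GRing.Lalgebra_isAlgebra.Build R quat quat_scaleAr.

Definition qconj x : quat :=
  let: Quat a0 a1 a2 a3 := x in Quat a0 (- a1) (- a2) (- a3).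

Lemma qconj_is_linear : linear qconj.
Proof.
move=> a [a0 a1 a2 a3] [b0 b1 b2 b3].
by congr Quat => /=; rewrite /GRing.scale /=; ring.
Qed.

HB.instance Definition _ :=
  GRing.isLinear.Build R quat quat *:%R qconj qconj_is_linear.

Lemma qconjD x y : qconj (x + y) = qconj x + qconj y.
Proof. exact: linearD. Qed.

Lemma qconjZ a x : qconj (a *: x) = a *: qconj x.
Proof. exact: linearZ. Qed.

Lemma qconjM x y : qconj (x * y) = qconj y * qconj x.
Proof.
move: x y => [a0 a1 a2 a3] [b0 b1 b2 b3].
by congr Quat; ring.
Qed.

Lemma qconjK : involutive qconj.
Proof. by move=> [a0 a1 a2 a3]; rewrite /qconj /= !opprK. Qed.

Definition qre x : R := q0 x.

Lemma qre_is_scalar : scalar qre.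
Proof. by move=> a [a0 a1 a2 a3] [b0 b1 b2 b3]. Qed.

HB.instance Definition _ :=
  GRing.isLinear.Build R quat R *%R qre qre_is_scalar.

Lemma quat_sum (I : finType) (F : I -> quat) :
  \sum_i F i = Quat (\sum_i q0 (F i)) (\sum_i q1 (F i))
                     (\sum_i q2 (F i)) (\sum_i q3 (F i)).
Proof.
elim: (index_enum _) => [|r s IHs]; rewrite ?big_nil // !big_cons IHs.
by case: (F r).
Qed.

Lemma qreB x y : qre (x - y) = qre x - qre y.
Proof. exact: linearB. Qed.

Lemma qreN x : qre (- x) = - qre x.
Proof. exact: linearN. Qed.

Lemma qreZ a x : qre (a *: x) = a * qre x.
Proof. exact: linearZ. Qed.

Lemma qre_sum (I : finType) (F : I -> quat) :
  qre (\sum_i F i) = \sum_i qre (F i).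
Proof. exact: linear_sum. Qed.

Lemma qreC x y : qre (x * y) = qre (y * x).
Proof.
move: x y => [a0 a1 a2 a3] [b0 b1 b2 b3].
by rewrite /= ; ring.
Qed.

Lemma qre_conj x : qre (qconj x) = qre x.
Proof. by move: x => [a0 a1 a2 a3]. Qed.

Definition qdot x y : R := qre (qconj x * y).

Lemma qdotE x y : qdot x y =
  let: Quat a0 a1 a2 a3 := x in let: Quat b0 b1 b2 b3 := y in
  a0 * b0 + a1 * b1 + a2 * b2 + a3 * b3.
Proof.
move: x y => [a0 a1 a2 a3] [b0 b1 b2 b3].
by rewrite /qdot /=; ring.
Qed.

Lemma qdotC x y : qdot x y = qdot y x.
Proof. by rewrite /qdot -qre_conj qconjM qconjK. Qed.

Lemma qdot_linr x : scalar (qdot x).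
Proof. by move=> a y z; rewrite /qdot mulrDr -scalerAr linearP. Qed.

HB.instance Definition _ x :=
  GRing.isLinear.Build R quat R *%R (qdot x) (qdot_linr x).

Lemma qdotBr x y z : qdot x (y - z) = qdot x y - qdot x z.
Proof. exact: linearB. Qed.

Lemma qdotNr x y : qdot x (- y) = - qdot x y.
Proof. exact: linearN. Qed.

Lemma qdotDr x y z : qdot x (y + z) = qdot x y + qdot x z.
Proof. exact: linearD. Qed.

Lemma qdotZr a x y : qdot x (a *: y) = a * qdot x y.
Proof. exact: linearZ. Qed.

Lemma qdotMnr x y m : qdot x (y *+ m) = qdot x y *+ m.
Proof. exact: linearMn. Qed.

Lemma qdot_sumr (I : finType) x (F : I -> quat) :
  qdot x (\sum_i F i) = \sum_i qdot x (F i).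
Proof. exact: linear_sum. Qed.

Lemma qdotDl x y z : qdot (x + y) z = qdot x z + qdot y z.
Proof. by rewrite ![qdot _ z]qdotC linearD. Qed.

Lemma qdotZl a x y : qdot (a *: x) y = a * qdot x y.
Proof. by rewrite ![qdot _ y]qdotC linearZ. Qed.

Lemma qdot_ge0 x : 0 <= qdot x x.
Proof.
by move: x => [a0 a1 a2 a3]; rewrite qdotE -!expr2 !addr_ge0 ?sqr_ge0.
Qed.

Lemma qdot_eq0 x : (qdot x x == 0) = (x == 0).
Proof.
move: x => [a0 a1 a2 a3]; rewrite qdotE -!expr2.
rewrite !paddr_eq0 ?addr_ge0 ?sqr_ge0 // !sqrf_eq0.
apply/idP/eqP => [/andP[/andP[/andP[]]]|[-> -> -> ->]]; last by rewrite eqxx.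
by move=> /eqP-> /eqP-> /eqP-> /eqP->.
Qed.

Lemma qdot_inj x y : (forall u, qdot u x = qdot u y) -> x = y.
Proof.
move=> xy; apply/eqP; rewrite -subr_eq0 -qdot_eq0 qdotBr.
by rewrite xy subrr.
Qed.

Definition qI : quat := Quat 0 1 0 0.

Definition qunit (a : 'I_4) : quat :=
  nth 0 [:: 1; qI; Quat 0 0 1 0; Quat 0 0 0 1] a.

Lemma qunit_sum x : x = \sum_a qdot (qunit a) x *: qunit a.
Proof.
rewrite !big_ord_recl big_ord0 addr0 /qunit /= !qdotE.
move: x => [a0 a1 a2 a3].
by congr Quat => /=; rewrite /GRing.scale /=; ring.
Qed.

(** This sum and the next three are the real traces of u |-> u c, conj(u) c, b u c and b conj(u) c
    on the quaternions. Each entry contributes such traces to the trace defining the Ricci form. *)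
Lemma qunit_mulr c : \sum_a qdot (qunit a) (qunit a * c) = 4 * qre c.
Proof.
rewrite !big_ord_recl big_ord0 addr0 /qunit /= !qdotE.
move: c => [c0 c1 c2 c3] /=; ring.
Qed.

Lemma qunit_conj_mulr c :
  \sum_a qdot (qunit a) (qconj (qunit a) * c) = - 2 * qre c.
Proof.
rewrite !big_ord_recl big_ord0 addr0 /qunit /= !qdotE.
move: c => [c0 c1 c2 c3] /=; ring.
Qed.

Lemma qunit_mullr b c :
  \sum_a qdot (qunit a) (b * qunit a * c) = 4 * (qre b * qre c).
Proof.
rewrite !big_ord_recl big_ord0 addr0 /qunit /= !qdotE.
move: b c => [b0 b1 b2 b3] [c0 c1 c2 c3] /=; ring.
Qed.

Lemma qunit_conj_mullr b c :
  \sum_a qdot (qunit a) (b * qconj (qunit a) * c) = - 2 * qdot b c.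
Proof.
rewrite !big_ord_recl big_ord0 addr0 /qunit /= !qdotE.
move: b c => [b0 b1 b2 b3] [c0 c1 c2 c3] /=; ring.
Qed.

End Quaternions.

Arguments quat_mul {R} x y : simpl never.
Arguments quat_add {R} x y : simpl never.
Arguments quat_opp {R} x : simpl never.
Arguments quat_scale {R} a x : simpl never.
Arguments qconj {R} x : simpl never.
Arguments qre {R} x : simpl never.
Arguments qdot {R} x y : simpl never.
Arguments qunit {R} a : simpl never.

(** * Quaternionic entries *)

Section Entries.
Variables (R : realType) (n : nat).
Implicit Types (A B : qmx R n) (X Y Z : sp R n) (lam : 'I_n -> 'I_n -> R).

Definition ent (p q : 'I_n) A : quat R :=
  Quat (re A p q) (im1 A p q) (im2 A p q) (im3 A p q).

Arguments ent : simpl never.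

Lemma ent_is_linear p q : linear (ent p q).
Proof.
move=> a [[[A0 A1] A2] A3] [[[B0 B1] B2] B3].
by rewrite /ent /= !mxE.
Qed.

HB.instance Definition _ p q :=
  GRing.isLinear.Build R (qmx R n) (quat R) *:%R (ent p q) (ent_is_linear p q).

Lemma ent_inj A B : (forall p q, ent p q A = ent p q B) -> A = B.
Proof.
move: A B => [[[A0 A1] A2] A3] [[[B0 B1] B2] B3] AB.
by congr (_, _, _, _); apply/matrixP => p q; case: (AB p q).
Qed.

Definition qmx_of (h : 'I_n -> 'I_n -> quat R) : qmx R n :=
  (\matrix_(p, q) q0 (h p q), \matrix_(p, q) q1 (h p q),
   \matrix_(p, q) q2 (h p q), \matrix_(p, q) q3 (h p q)).

Lemma ent_qmx_of h p q : ent p q (qmx_of h) = h p q.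
Proof. by rewrite /ent /= !mxE; case: (h p q). Qed.

Lemma ent_qid p q : ent p q (qid R n) = (p == q)%:R.
Proof. by rewrite /ent /= !mxE; case: (p == q). Qed.

Lemma ent_qadj A p q : ent p q (qadj A) = qconj (ent q p A).
Proof. by move: A => [[[A0 A1] A2] A3]; rewrite /ent /= !mxE. Qed.

Lemma ent_qmul_mx A B p q : ent p q (qmul A B) = Quat
  ((re A *m re B - im1 A *m im1 B - im2 A *m im2 B - im3 A *m im3 B) p q)
  ((re A *m im1 B + im1 A *m re B + im2 A *m im3 B - im3 A *m im2 B) p q)
  ((re A *m im2 B - im1 A *m im3 B + im2 A *m re B + im3 A *m im1 B) p q)
  ((re A *m im3 B + im1 A *m im2 B - im2 A *m im1 B + im3 A *m re B) p q).
Proof. by []. Qed.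

Lemma ent_qmul A B p q :
  ent p q (qmul A B) = \sum_r ent p r A * ent r q B.
Proof.
have -> : \sum_r ent p r A * ent r q B =
  \sum_r Quat
    (re A p r * re B r q - im1 A p r * im1 B r q -
     im2 A p r * im2 B r q - im3 A p r * im3 B r q)
    (re A p r * im1 B r q + im1 A p r * re B r q +
     im2 A p r * im3 B r q - im3 A p r * im2 B r q)
    (re A p r * im2 B r q - im1 A p r * im3 B r q +
     im2 A p r * re B r q + im3 A p r * im1 B r q)
    (re A p r * im3 B r q + im1 A p r * im2 B r q -
     im2 A p r * im1 B r q + im3 A p r * re B r q).
  by [].
rewrite quat_sum ent_qmul_mx !(mxDE, mxNE) !mxE /=.
by rewrite !(sumrB, big_split).
Qed.

Definition spe (p q : 'I_n) X : quat R := ent p q (vsval X).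

Arguments spe : simpl never.

Lemma spe_is_linear p q : linear (spe p q).
Proof.
move=> a X Y; rewrite /spe.
have -> : vsval (a *: X + Y) = a *: vsval X + vsval Y := linearP vsval a X Y.
exact: ent_is_linear.
Qed.

HB.instance Definition _ p q :=
  GRing.isLinear.Build R (sp R n) (quat R) *:%R (spe p q) (spe_is_linear p q).

Lemma spe_inj X Y : (forall p q, spe p q X = spe p q Y) -> X = Y.
Proof. by move=> XY; apply/val_inj/ent_inj. Qed.

Lemma spe_conj p q X : qconj (spe q p X) = - spe p q X.
Proof. by rewrite /spe -ent_qadj sp_adj linearN. Qed.

Lemma spe_br p q X Y :
  spe p q (sp_br X Y) = \sum_r (spe p r X * spe r q Y - spe p r Y * spe r q X).
Proof. by rewrite /spe vsval_sp_br linearB /= !ent_qmul -sumrB. Qed.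

(** Accepting an arbitrary array allows elements and endomorphisms of sp(n) to be given by formulas
    without any symmetry in p and q. *)
Definition skewpart (h : 'I_n -> 'I_n -> quat R) : sp R n :=
  vsproj (sp_space R n)
    (qmx_of (fun p q => 2^-1 *: (h p q - qconj (h q p)))).

Lemma spe_skewpart h p q : spe p q (skewpart h) = 2^-1 *: (h p q - qconj (h q p)).
Proof.
rewrite /spe vsprojK ?ent_qmx_of // sp_spaceE; apply/eqP/ent_inj => {}p {}q.
rewrite ent_qadj linearN /= !ent_qmx_of linearZ linearB /= qconjK.
by rewrite -scalerN opprB.
Qed.

(** The spare test [b] matches the double test in [eunit]; a plain delta is the case [b = true]. *)
Lemma sum_delta (V : nmodType) (F : 'I_n -> V) t b :
  \sum_r F r *+ ((r == t) && b) = F t *+ b.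
Proof.
rewrite (bigD1 t) //= eqxx big1 ?addr0 // => r /negPf->; by rewrite mulr0n.
Qed.

Definition eunit (s t : 'I_n) (a : 'I_4) (p q : 'I_n) : quat R :=
  qunit a *+ ((p == s) && (q == t)).

(** The frame formula is applied to [skewpart (eunit s t a)] for all s, t, a. This redundant family
    avoids restricting to s <= t and treating the diagonal apart. The functionals are the quaternion
    coordinates of [F X s t], taken before projection. *)
Lemma endo_trace_skew (F : sp R n -> 'I_n -> 'I_n -> quat R) :
  (forall s t, linear (fun X => F X s t)) ->
  endo_trace (fun X => skewpart (F X)) =
  \sum_s \sum_t \sum_a qdot (qunit a) (F (skewpart (eunit s t a)) s t).
Proof.
move=> F_lin.
pose psi (j : 'I_n * 'I_n * 'I_4) X := qdot (qunit j.2) (F X j.1.1 j.1.2).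
pose e (j : 'I_n * 'I_n * 'I_4) := skewpart (eunit j.1.1 j.1.2 j.2).
have coefE X p q : \sum_j psi j X *: eunit j.1.1 j.1.2 j.2 p q = F X p q.
  rewrite -(pair_bigA _ (fun st a => psi (st, a) X *: eunit st.1 st.2 a p q)).
  rewrite -(pair_bigA _ (fun s t => \sum_a psi (s, t, a) X *: eunit s t a p q)).
  rewrite (bigD1 p) //= (bigD1 q) //=.
  rewrite [X in _ + X + _]big1 => [|t tq]; last first.
    by apply: big1 => a _; rewrite /eunit [q == t]eq_sym (negPf tq) andbF scaler0.
  rewrite addr0 [X in _ + X]big1 ?addr0 => [|s sp].
    by rewrite [RHS]qunit_sum; apply: eq_bigr => a _; rewrite /eunit !eqxx.
  apply: big1 => t _; apply: big1 => a _.
  by rewrite /eunit [p == s]eq_sym (negPf sp) scaler0.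
rewrite (@endo_trace_frame _ _ _ _ psi e) => [|j a X Y|X].
- rewrite -(pair_bigA _ (fun st a => psi (st, a) (e (st, a)))).
  by rewrite -(pair_bigA _ (fun s t => \sum_a psi (s, t, a) (e (s, t, a)))).
- by rewrite /psi F_lin linearP.
- apply: spe_inj => p q; rewrite spe_skewpart linear_sum /=.
  rewrite -!coefE linear_sum -sumrB scaler_sumr; apply: eq_bigr => j _.
  rewrite [RHS]linearZ [X in _ - X]linearZ /= spe_skewpart.
  by rewrite -scalerBr scalerA mulrC -scalerA.
Qed.

(** On skew-Hermitian matrices this is -Re tr(XY), a negative multiple of the Killing form. *)
Definition dotf X Y : R := \sum_p \sum_q qdot (spe p q X) (spe p q Y).

Lemma dotf_linl Y : scalar (dotf^~ Y).
Proof.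
move=> a X Z; rewrite /dotf mulr_sumr -big_split; apply: eq_bigr => p _ /=.
rewrite mulr_sumr -big_split; apply: eq_bigr => q _ /=.
by rewrite linearP qdotDl qdotZl.
Qed.

Lemma dotfC X Y : dotf X Y = dotf Y X.
Proof. by apply: eq_bigr => p _; apply: eq_bigr => q _; rewrite qdotC. Qed.

Lemma dotf_eq0 X : (dotf X X == 0) = (X == 0).
Proof.
apply/eqP/eqP => [/eqP|->]; last first.
  by apply: big1 => p _; apply: big1 => q _; rewrite !linear0.
rewrite psumr_eq0 => [/allP X0|p _]; last first.
  by apply: sumr_ge0 => q _; exact: qdot_ge0.
apply: spe_inj => p q; have := X0 p (mem_index_enum _).
rewrite psumr_eq0 /= => [/allP/(_ q (mem_index_enum _))|? _]; last exact: qdot_ge0.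
by rewrite linear0 qdot_eq0 => /eqP.
Qed.

Lemma dotf_nondeg X : (forall Y, dotf X Y = 0) -> X = 0.
Proof. by move=> X0; apply/eqP; rewrite -dotf_eq0 X0. Qed.

(** This is Re tr(XYZ). Its cyclicity is what makes [dotf] ad-invariant. *)
Let t3 X Y Z := \sum_p \sum_q \sum_r qre (spe p q X * spe q r Y * spe r p Z).

Let t3C X Y Z : t3 X Y Z = t3 Y Z X.
Proof.
rewrite /t3 exchange_big; apply: eq_bigr => q _ /=.
rewrite exchange_big; apply: eq_bigr => r _ /=; apply: eq_bigr => p _.
by rewrite -mulrA qreC.
Qed.

Let dotf_br X Y Z : dotf (sp_br X Y) Z = t3 Y X Z - t3 X Y Z.
Proof.
rewrite /dotf exchange_big /t3 -sumrB; apply: eq_bigr => q _ /=.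
transitivity (\sum_p - qre (spe q p (sp_br X Y) * spe p q Z)).
  by apply: eq_bigr => p _; rewrite /qdot spe_conj mulNr qreN.
rewrite [X in X - _]exchange_big [X in _ - X]exchange_big -sumrB.
apply: eq_bigr => p _; rewrite -sumrB spe_br mulr_suml qre_sum -sumrN.
by apply: eq_bigr => r _; rewrite mulrBl qreB opprB.
Qed.

Lemma dotf_inv X Y Z : dotf (sp_br X Y) Z = - dotf Y (sp_br X Z).
Proof.
rewrite [dotf Y _]dotfC !dotf_br opprB.
by rewrite (t3C X Z Y) (t3C Z Y X) (t3C Z X Y).
Qed.

End Entries.

Arguments ent {R n} p q A : simpl never.
Arguments spe {R n} p q X : simpl never.

(** * Ricci form of entrywise scaled metrics *)

Section SpRicci.
Variables (R : realType) (n : nat).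
Implicit Types (X Y Z U V W : sp R n).

Lemma sp_brC X Y : sp_br X Y = - sp_br Y X.
Proof.
apply: spe_inj => p q; rewrite linearN /= !spe_br -sumrN.
by apply: eq_bigr => r _; rewrite opprB.
Qed.

Lemma sp_br_linr X : linear (sp_br X).
Proof.
move=> a Y Z; apply: spe_inj => p q; rewrite linearP /= !spe_br.
rewrite scaler_sumr -big_split; apply: eq_bigr => r _ /=.
rewrite !linearP /= mulrDr mulrDl -scalerAr -scalerAl opprD scalerBr.
by rewrite addrACA.
Qed.

Lemma sp_br_linl Y : linear ((@sp_br R n)^~ Y).
Proof.
move=> a X Z; rewrite [sp_br _ Y]sp_brC sp_br_linr opprD -scalerN.
by rewrite -!(sp_brC _ Y).
Qed.

Lemma sp_brBl X Y Z : sp_br (X - Y) Z = sp_br X Z - sp_br Y Z.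
Proof. by rewrite addrC -scaleN1r sp_br_linl scaleN1r addrC. Qed.

Lemma sp_brNl X Y : sp_br (- X) Y = - sp_br X Y.
Proof. by rewrite -[- X]sub0r -{1}(subrr X) !sp_brBl subrr sub0r. Qed.

Lemma sp_brNr X Y : sp_br X (- Y) = - sp_br X Y.
Proof. by rewrite sp_brC sp_brNl -sp_brC. Qed.

Lemma sp_brBr X Y Z : sp_br X (Y - Z) = sp_br X Y - sp_br X Z.
Proof. by rewrite addrC -scaleN1r sp_br_linr scaleN1r addrC. Qed.

(** For symmetric [lam] the array is already skew-Hermitian and the projection does nothing
    ([spe_rescale]); it only makes the definition total. *)
Definition rescale (lam : 'I_n -> 'I_n -> R) X : sp R n :=
  skewpart (fun p q => lam p q *: spe p q X).

Lemma rescale_is_linear lam : linear (rescale lam).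
Proof.
move=> a X Y; apply: spe_inj => p q; rewrite (linearP (spe p q)) /=.
rewrite !spe_skewpart !(linearP (spe _ _)) /=.
rewrite !(qconjZ, qconjD).
by apply: qdot_inj => u; rewrite !(qdotDr, qdotBr, qdotZr, qdotNr); ring.
Qed.

HB.instance Definition _ lam :=
  GRing.isLinear.Build R (sp R n) (sp R n) *:%R (rescale lam)
    (rescale_is_linear lam).

(* [scaled_nabla X Y] is the skew-Hermitian part of the matrix with entries
   sum_r alpha_prq X_pr Y_rq. *)
Definition alpha (lam : 'I_n -> 'I_n -> R) (p r q : 'I_n) : R :=
  1 + (lam r q - lam p r) / lam p q.

Variable lam : 'I_n -> 'I_n -> R.
Hypothesis lamC : forall p q, lam p q = lam q p.
Hypothesis lam_neq0 : forall p q, lam p q != 0.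

Lemma spe_rescale (mu : 'I_n -> 'I_n -> R) p q X :
  (forall p q, mu p q = mu q p) ->
  spe p q (rescale mu X) = mu p q *: spe p q X.
Proof.
move=> muC; rewrite spe_skewpart linearZ /= spe_conj muC.
by apply: qdot_inj => u; rewrite !(qdotBr, qdotZr, qdotNr); field.
Qed.

Definition scaled_nabla : sp R n -> sp R n -> sp R n :=
  koszul (@sp_br R n) (rescale lam) (rescale (fun p q => (lam p q)^-1)).

Definition half_nabla X Y (p q : 'I_n) : quat R :=
  \sum_r alpha lam p r q *: (spe p r X * spe r q Y).

Lemma scaled_nablaE X Y : scaled_nabla X Y = skewpart (half_nabla X Y).
Proof.
apply: spe_inj => p q; rewrite spe_skewpart /scaled_nabla /koszul.
rewrite linearZ linearD /= spe_rescale => [|? ?]; last by rewrite lamC.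
rewrite linearB /= !spe_br -sumrB scaler_sumr -big_split; congr (_ *: _).
rewrite /half_nabla linear_sum -sumrB; apply: eq_bigr => r _ /=.
rewrite !spe_rescale // linearZ /= qconjM !spe_conj mulrNN.
rewrite -!scalerAl -!scalerAr /alpha [lam q p]lamC [lam r p]lamC [lam q r]lamC.
apply: qdot_inj => u; rewrite !(qdotDr, qdotBr, qdotZr, qdotNr).
by field.
Qed.

Lemma half_nabla_linl Y p q : linear (fun X => half_nabla X Y p q).
Proof.
move=> a X Z; rewrite /half_nabla scaler_sumr -big_split.
apply: eq_bigr => r _ /=; rewrite linearP mulrDl -scalerAl /= scalerDr.
by rewrite !scalerA mulrC.
Qed.

Lemma scaled_nabla_linl Y : linear (scaled_nabla^~ Y).
Proof.
move=> a X Z; rewrite !scaled_nablaE; apply: spe_inj => p q.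
rewrite linearP /= !spe_skewpart !half_nabla_linl linearP /=.
by apply: qdot_inj => u; rewrite !(qdotDr, qdotBr, qdotZr, qdotNr); ring.
Qed.

Lemma levi_civita_scaled :
  levi_civita (@sp_br R n) (fun X Y => dotf (rescale lam X) Y) scaled_nabla.
Proof.
apply: levi_civita_koszul.
- exact: sp_brC.
- exact: dotf_linl.
- exact: dotfC.
- exact: dotf_inv.
- move=> X Y; apply: eq_bigr => p _; apply: eq_bigr => q _.
  by rewrite !spe_rescale // qdotZl qdotZr.
- move=> X; apply: spe_inj => p q; rewrite spe_rescale // spe_rescale.
    by rewrite scalerA mulfV // scale1r.
  by move=> ? ?; rewrite lamC.
Qed.

(** Torsion-freeness carries linearity over from the first argument. *)
Lemma scaled_nabla_linr X : linear (scaled_nabla X).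
Proof.
move=> a Y Z; have [tf _] := levi_civita_scaled.
have swap V : scaled_nabla X V = scaled_nabla V X + sp_br X V.
  by rewrite -tf addrC subrK.
by rewrite !swap sp_br_linr scaled_nabla_linl scalerDr addrACA.
Qed.

Section UnitSums.
Variables (s t : 'I_n) (a : 'I_4).
Let U := @skewpart R n (eunit R s t a).

Lemma spe_eunit p q : spe p q U = 2^-1 *:
  (qunit a *+ ((p == s) && (q == t)) - qconj (qunit a) *+ ((q == s) && (p == t))).
Proof. by rewrite spe_skewpart /eunit linearMn. Qed.

Lemma row_eunit_sum (c : 'I_n -> R) (V : 'I_n -> quat R) :
  \sum_r c r *: (spe s r U * V r) = 2^-1 *:
  (c t *: (qunit a * V t) - (c s *: (qconj (qunit a) * V s)) *+ (s == t)).
Proof.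
(* The first term has lost its second test to [eqxx]; writing it as [true] lets [sum_delta] apply to
   both terms. *)
rewrite -[X in _ *: (X - _)]mulr1n -[1%N]/(nat_of_bool true).
rewrite -!(sum_delta (fun r => c r *: (_ * V r))) -sumrB scaler_sumr.
apply: eq_bigr => r _; rewrite spe_eunit eqxx andbT /=.
rewrite -scalerAl scalerA mulrC -scalerA mulrBl scalerBr.
by rewrite !mulrnAl !scalerMnr.
Qed.

Lemma col_eunit_sum (c : 'I_n -> R) (V : 'I_n -> quat R) r :
  \sum_q c q *: (V q * spe q r U) = 2^-1 *:
  ((c s *: (V s * qunit a)) *+ (r == t) -
   (c t *: (V t * qconj (qunit a))) *+ (r == s)).
Proof.
rewrite -!(sum_delta (fun q => c q *: (V q * _))) -sumrB scaler_sumr.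
apply: eq_bigr => q _; rewrite spe_eunit [(r == s) && _]andbC.
rewrite -scalerAr scalerA mulrC -scalerA mulrBr scalerBr.
by rewrite !mulrnAr !scalerMnr.
Qed.

Lemma half_nabla_eunit W q : half_nabla U W s q = 2^-1 *:
  (alpha lam s t q *: (qunit a * spe t q W) -
   (alpha lam s s q *: (qconj (qunit a) * spe s q W)) *+ (s == t)).
Proof. exact: (row_eunit_sum (fun r => alpha lam s r q)). Qed.

End UnitSums.

Lemma qre_diag X p : qre (spe p p X) = 0.
Proof.
have /(congr1 (@qre R)) := spe_conj p p X; rewrite qre_conj qreN; lra.
Qed.

(** Only real parts of diagonal entries of W survive the sum over the unit quaternions, and these
    vanish. Hence the first trace in [ricci_trace] is zero. *)
Lemma trace_scaled_nabla W : endo_trace (scaled_nabla^~ W) = 0.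
Proof.
rewrite (_ : scaled_nabla^~ W = fun X => skewpart (half_nabla X W)); last first.
  by apply/funext => X; rewrite scaled_nablaE.
rewrite endo_trace_skew => [|s t]; last exact: half_nabla_linl.
apply: big1 => s _; apply: big1 => t _.
under eq_bigr => a _ do
  rewrite half_nabla_eunit qdotZr qdotBr qdotZr.
rewrite -mulr_sumr sumrB -mulr_sumr qunit_mulr qre_diag !mulr0 sub0r.
case: eqP => [->|_]; last by rewrite big1 ?oppr0 ?mulr0 // => a _; rewrite linear0.
under eq_bigr => a _ do rewrite mulr1n qdotZr.
by rewrite -mulr_sumr qunit_conj_mulr qre_diag !mulr0 oppr0 mulr0.
Qed.

(** The coefficient of the (r, t) entries in the Ricci form ([scaled_ricci]): the metric is Einstein
    as soon as [ric] is a constant multiple of [lam]. The terms with 2^-1 come from the conjugate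
    half of the frame elements. *)
Definition ric (r t : 'I_n) : R :=
  \sum_s alpha lam s r t * alpha lam s t r +
  2^-1 * (alpha lam r r t + alpha lam t t r).

Lemma trace_scaled_nabla2 Y Z :
  endo_trace (fun X => scaled_nabla (scaled_nabla X Y) Z) =
  - \sum_r \sum_t ric r t * qdot (spe r t Y) (spe r t Z).
Proof.
rewrite (_ : (fun X => _) =
    fun X => skewpart (half_nabla (scaled_nabla X Y) Z)); last first.
  by apply/funext => X; rewrite scaled_nablaE.
rewrite endo_trace_skew => [|s t]; last first.
  by move=> a U V; rewrite scaled_nabla_linl half_nabla_linl.
pose D r t := qdot (spe r t Y) (spe r t Z).
have qreD r t : qre (spe t r Y * spe r t Z) = - D r t.
  by rewrite /D /qdot spe_conj mulNr qreN opprK.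
(* One factor 1/2 comes from the frame element, the other from the projection in [scaled_nablaE].
   The last two terms are the conjugate of the (r, s) entry. *)
have inner s t a r : spe s r (scaled_nabla (skewpart (eunit R s t a)) Y) = 4^-1 *:
    (alpha lam s t r *: (qunit a * spe t r Y)
     - (alpha lam s s r *: (qconj (qunit a) * spe s r Y)) *+ (s == t)
     - (alpha lam r s s *: (spe s s Y * qunit a)) *+ (r == t)
     + (alpha lam r t s *: (spe s t Y * qconj (qunit a))) *+ (r == s)).
  rewrite scaled_nablaE spe_skewpart half_nabla_eunit.
  rewrite (_ : qconj (half_nabla _ Y r s) = \sum_q alpha lam r q s *:
      (spe s q Y * spe q r (skewpart (eunit R s t a)))); last first.
    rewrite /half_nabla linear_sum; apply: eq_bigr => q _.
    by rewrite linearZ /= qconjM !spe_conj mulrNN.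
  rewrite [X in _ - X](col_eunit_sum s t a (fun q => alpha lam r q s)
    (fun q => spe s q Y)).
  apply: qdot_inj => u; rewrite !(qdotDr, qdotBr, qdotZr, qdotNr).
  by field.
(* The [(r == t)] term of [inner] drops out because Re Y_ss = 0. In the other two delta terms the
   equality of indices brings the entries of Y and Z to the same position. *)
have summand s t r : \sum_a qdot (qunit a)
    (spe s r (scaled_nabla (skewpart (eunit R s t a)) Y) * spe r t Z) =
    - alpha lam s t r * D r t
    - (2^-1 * (alpha lam s s r * D r s)) *+ (s == t)
    - (2^-1 * (alpha lam r t s * D s t)) *+ (r == s).
  have -> : \sum_a qdot (qunit a)
      (spe s r (scaled_nabla (skewpart (eunit R s t a)) Y) * spe r t Z) =
    4^-1 * (alpha lam s t r *
        (\sum_a qdot (qunit a) (qunit a * (spe t r Y * spe r t Z)))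
     - (alpha lam s s r *
        (\sum_a qdot (qunit a) (qconj (qunit a) * (spe s r Y * spe r t Z))))
       *+ (s == t)
     - (alpha lam r s s *
        (\sum_a qdot (qunit a) (spe s s Y * qunit a * spe r t Z))) *+ (r == t)
     + (alpha lam r t s *
        (\sum_a qdot (qunit a) (spe s t Y * qconj (qunit a) * spe r t Z)))
       *+ (r == s)).
    rewrite !mulr_sumr -!sumrMnl -!sumrB -big_split mulr_sumr.
    apply: eq_bigr => a _ /=; rewrite inner -scalerAl qdotZr; congr (_ * _).
    move: (alpha lam s t r) (alpha lam s s r) (alpha lam r s s) (alpha lam r t s).
    move=> c1 c2 c3 c4; rewrite !(mulrDl, mulNr, mulrnAl) -!scalerAl !mulrA.
    by rewrite !(qdotDr, qdotNr, qdotMnr, qdotZr).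
  rewrite qunit_mulr qunit_conj_mulr qunit_mullr qunit_conj_mullr qre_diag qreD.
  rewrite mul0r !mulr0 mul0rn subr0.
  have -> : (alpha lam s s r * (- 2 * qre (spe s r Y * spe r t Z))) *+ (s == t) =
     (alpha lam s s r * (2 * D r s)) *+ (s == t).
    by case: eqP => [<-|//]; rewrite qreD mulrNN.
  have -> : (alpha lam r t s * (- 2 * qdot (spe s t Y) (spe r t Z))) *+ (r == s) =
     (alpha lam r t s * (- 2 * D s t)) *+ (r == s).
    by case: eqP => [->|//].
  by case: (s == t); case: (r == s); rewrite /= ?mulr1n ?mulr0n; field.
(* In each delta term one of the two [alpha] factors has equal outer indices, so a single [alpha]
   remains there. *)
have alpha1 s r : alpha lam s r s = 1.
  by rewrite /alpha [lam s r]lamC subrr mul0r addr0.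
transitivity (- \sum_s (\sum_t \sum_r alpha lam s r t * alpha lam s t r * D r t +
    2^-1 * (\sum_r alpha lam s s r * D r s + \sum_t alpha lam s s t * D s t))).
  rewrite -sumrN; apply: eq_bigr => s _.
  transitivity (\sum_t \sum_r alpha lam s r t *
      (- alpha lam s t r * D r t
      - (2^-1 * (alpha lam s s r * D r s)) *+ (s == t)
      - (2^-1 * (alpha lam r t s * D s t)) *+ (r == s))).
    apply: eq_bigr => t _.
    under eq_bigr => a _ do rewrite /half_nabla qdot_sumr.
    rewrite exchange_big; apply: eq_bigr => r _ /=.
    under eq_bigr => a _ do rewrite qdotZr.
    by rewrite -mulr_sumr summand.
  transitivity (\sum_t \sum_r (- (alpha lam s r t * alpha lam s t r * D r t)
      - (2^-1 * (alpha lam s s r * D r s)) *+ ((t == s) && true)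
      - (2^-1 * (alpha lam s s t * D s t)) *+ ((r == s) && true))).
    apply: eq_bigr => t _; apply: eq_bigr => r _; rewrite !andbT [t == s]eq_sym.
    case: (eqVneq s t) => [<-|_]; case: (eqVneq r s) => [->|_];
      rewrite /= ?mulr1n ?mulr0n ?alpha1; ring.
  under eq_bigr do rewrite !sumrB sumrN sum_delta.
  rewrite !sumrB sumrN [X in _ - X - _]exchange_big.
  under [X in _ - X - _]eq_bigr do rewrite sum_delta.
  by rewrite -addrA -opprD -opprD mulrDr !mulr_sumr.
have sum3C (F : 'I_n -> 'I_n -> 'I_n -> R) :
    \sum_s \sum_t \sum_r F s t r = \sum_r \sum_t \sum_s F s t r.
  rewrite exchange_big; under eq_bigr do rewrite exchange_big.
  exact: exchange_big.
congr (- _); rewrite big_split -mulr_sumr big_split sum3C /=.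
rewrite [X in 2^-1 * (X + _)]exchange_big /= -big_split mulr_sumr -big_split.
apply: eq_bigr => r _ /=; rewrite -big_split mulr_sumr -big_split.
apply: eq_bigr => t _ /=; rewrite /ric [RHS]mulrDl mulr_suml -/(D r t).
by congr (_ + _); ring.
Qed.

Lemma scaled_ricci Y Z : ricci (@sp_br R n) scaled_nabla Y Z =
  \sum_r \sum_t ric r t * qdot (spe r t Y) (spe r t Z).
Proof.
have [torsion_free _] := levi_civita_scaled.
rewrite (ricci_trace Y Z scaled_nabla_linl scaled_nabla_linr torsion_free).
transitivity (0 - - \sum_r \sum_t ric r t * qdot (spe r t Y) (spe r t Z)).
  congr (_ - _).
    exact: trace_scaled_nabla.
  exact: trace_scaled_nabla2.
by rewrite sub0r opprK.
Qed.

End SpRicci.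

(** * Solutions of the Einstein equations *)

Section EinsteinParameters.
Variables (R : realType) (k l : R).
Hypotheses (k_ge1 : 1 <= k) (lt_kl : k + 1 <= l).

Local Ltac klra := move: (k_ge1) (lt_kl); intros; lra.

(* Here [a = r * b], and [c] is the Einstein constant.  [param_c] is the equation
   of the (1, 2) block, [param_r] that of the first diagonal block after
   eliminating [c] and the factor [r - 1], [param_d] that of the (1, 3) block,
   and [param_F] that of the third diagonal block. *)
Definition param_r (b : R) := (k + 1) / (3 * k + 1 + l * b ^+ 2).
Definition param_c (b : R) := (2 * k + 1) * (2 - param_r b) / b + l * b.
Definition param_d (b : R) :=
  (4 * k + 2 * l + 2 - (k + 2^-1) * (param_r b * b) - k * b - param_c b) /
  (l + 2^-1).
Definition param_F (b : R) :=
  2 * k * param_d b ^+ 2 - param_c b * param_d b + l + 1.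

Let sqr_scale_ge0 (u v : R) : 0 <= u -> 0 <= u * v ^+ 2.
Proof. by move=> u_ge0; apply: mulr_ge0 (sqr_ge0 v). Qed.

Let denom_gt0 b : 0 < 3 * k + 1 + l * b ^+ 2.
Proof. have lb_ge0 : 0 <= l * b ^+ 2 by apply: sqr_scale_ge0; klra.
by klra. Qed.

Lemma param_r_bounds (b : R) : 0 < param_r b < 1.
Proof.
rewrite /param_r divr_gt0 ?denom_gt0 //=; last by klra.
rewrite ltr_pdivrMr ?denom_gt0 // mul1r.
have lb_ge0 : 0 <= l * b ^+ 2 by apply: sqr_scale_ge0; klra.
by klra.
Qed.

Lemma param_c_ge (b : R) : 0 < b -> (2 * k + 1) / b + l * b <= param_c b.
Proof.
move=> b_gt0; have /andP[_ r_lt1] := param_r_bounds b.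
rewrite /param_c lerD2r ler_pM2r ?invr_gt0 //.
by rewrite ler_peMr; klra.
Qed.

Lemma param_c_gt0 (b : R) : 0 < b -> 0 < param_c b.
Proof.
move=> b_gt0; apply: lt_le_trans (param_c_ge b_gt0).
by rewrite addr_gt0 ?divr_gt0 ?mulr_gt0 //; klra.
Qed.

(** Since c > 0, every term of [param_F] is nonnegative when d <= 0, and l + 1 is positive. This
    gives the sign near 0 and near infinity, where the formula for d becomes negative. *)
Lemma param_F_gt0 (b : R) : 0 < b -> param_d b <= 0 -> 0 < param_F b.
Proof.
move=> b_gt0 d_le0; have c_gt0 := param_c_gt0 b_gt0.
have := mulr_ge0_le0 (ltW c_gt0) d_le0.
have : 0 <= 2 * k * param_d b ^+ 2 by apply: sqr_scale_ge0; klra.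
by rewrite /param_F; klra.
Qed.

(** The numerator of [param_d] is at most 4k + 2l + 2 - c, and [param_c_ge] bounds c below by (2k +
    1)/b + l b. *)
Lemma param_d_le0 (b : R) : 0 < b -> 4 * k + 2 * l + 2 <= (2 * k + 1) / b + l * b ->
  param_d b <= 0.
Proof.
move=> b_gt0 b_large; have c_ge := param_c_ge b_gt0.
have /andP[r_gt0 _] := param_r_bounds b.
rewrite /param_d pmulr_lle0 ?invr_gt0; last by klra.
have : 0 < (k + 2^-1) * (param_r b * b).
  by apply: mulr_gt0; [klra|exact: mulr_gt0].
have : 0 < k * b by rewrite mulr_gt0 //; klra.
by klra.
Qed.

(** With l = k + 1 + t and t >= 0, the value F(1) is minus a polynomial in k and t with positive
    coefficients, divided by a square. *)
Lemma param_F1_lt0 : param_F 1 < 0.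
Proof.
pose t := l - k - 1; have t_ge0 : 0 <= t by rewrite /t; klra.
have lE : l = k + 1 + t by rewrite /t; klra.
have k_ge0 : 0 <= k by klra.
have den_gt0 := denom_gt0 1; rewrite expr1n mulr1 in den_gt0.
have e_gt0 : 0 < l + 2^-1 by klra.
have -> : param_F 1 = - (3/4 + (11/4) * t + (15/4) * t^+2 + (9/4) * t^+3 + (1/2) * t^+4
   + (15/2) * k + 22 * (k * t) + (45/2) * (k * t^+2) + 9 * (k * t^+3) + k * t^+4
   + (111/4) * k^+2 + (249/4) * (k^+2 * t) + (87/2) * (k^+2 * t^+2) + 9 * (k^+2 * t^+3)
   + 45 * k^+3 + 72 * (k^+3 * t) + 27 * (k^+3 * t^+2) + 27 * k^+4 + 27 * (k^+4 * t))
   / ((l + 2^-1) * (3 * k + 1 + l)) ^+ 2.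
  rewrite /param_F /param_d /param_c /param_r expr1n !mulr1 divr1 lE.
  by field; rewrite !gt_eqF //; klra.
rewrite mulNr oppr_lt0 divr_gt0 ?exprn_gt0 ?mulr_gt0 //.
by rewrite !ltr_pwDl // ?mulr_ge0 ?exprn_ge0 //; klra.
Qed.

Let param_r_continuous (b : R) : {for b, continuous param_r}.
Proof.
rewrite /param_r; apply: cvgM; first exact: cvg_cst.
apply: cvgV; first by rewrite gt_eqF.
apply: cvgD; first exact: cvg_cst.
by apply: cvgM; [exact: cvg_cst|exact: exprn_continuous].
Qed.

Lemma param_F_continuous (b : R) : 0 < b -> {for b, continuous param_F}.
Proof.
move=> b_gt0; have b_neq0 : b != 0 by rewrite gt_eqF.
have c_cont : {for b, continuous param_c}.
  apply: cvgD; last by apply: cvgM; [exact: cvg_cst|exact: cvg_id].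
  apply: cvgM; last by apply: cvgV => //; exact: cvg_id.
  apply: cvgM; first exact: cvg_cst.
  by apply: cvgB; [exact: cvg_cst|exact: param_r_continuous].
have d_cont : {for b, continuous param_d}.
  apply: cvgM; last exact: cvg_cst.
  apply: cvgB => //; apply: cvgB; last first.
    by apply: cvgM; [exact: cvg_cst|exact: cvg_id].
  apply: cvgB; first exact: cvg_cst.
  apply: cvgM; first exact: cvg_cst.
  by apply: cvgM; [exact: param_r_continuous|exact: cvg_id].
apply: cvgD; last exact: cvg_cst.
apply: cvgD; last exact: cvg_cst.
apply: cvgB; last exact: cvgM.
apply: cvgM; first exact: cvg_cst.
exact: cvgM.
Qed.

Lemma param_F_root (x y : R) : 0 < x -> x < y -> param_F x * param_F y < 0 ->
  exists2 b, x < b < y & param_F b = 0.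
Proof.
move=> x_gt0 lt_xy signs.
have F_cont : {within `[x, y]%classic, continuous param_F}.
  apply: continuous_in_subspaceT => b; rewrite inE /= in_itv /= => /andP[le_xb _].
  by apply: param_F_continuous; exact: lt_le_trans le_xb.
have [|b /[!in_itv]/= /andP[le_xb le_by] Fb0] := IVT (ltW lt_xy) F_cont (v := 0).
  rewrite ge_min le_max; case: (ltgtP (param_F x) 0) (signs) => [Fx|Fx|->].
  - by rewrite nmulr_rlt0 // => /ltW ->; rewrite orbT.
  - by rewrite pmulr_rlt0 // => /ltW ->; rewrite orbT.
  - by rewrite mul0r ltxx.
(* The values at x and y have a negative product, so neither endpoint is a root. *)
exists b => //; rewrite !lt_neqAle le_xb le_by !andbT.
apply/andP; split; apply: contraTneq signs => e; move: Fb0; rewrite -?e.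
  by rewrite e => ->; rewrite mul0r ltxx.
by move=> Fy0; rewrite e in Fy0 *; rewrite Fy0 mulr0 ltxx.
Qed.

Lemma param_F_roots : exists b1 b2 : R,
  [/\ 0 < b1, b1 < 1, 1 < b2, param_F b1 = 0 & param_F b2 = 0].
Proof.
pose S := 4 * k + 2 * l + 2; have S_gt0 : 0 < S by rewrite /S; klra.
have k1_gt0 : 0 < 2 * k + 1 by klra.
have l_gt0 : 0 < l by klra.
(* At x the term (2k + 1)/b equals S, at y the term l b does; each alone meets the hypothesis of
   [param_d_le0]. *)
pose x := (2 * k + 1) / S; have x_gt0 : 0 < x by rewrite divr_gt0.
pose y := S / l; have y_gt0 : 0 < y by rewrite divr_gt0.
have x_lt1 : x < 1 by rewrite ltr_pdivrMr // /S; klra.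
have y_gt1 : 1 < y by rewrite ltr_pdivlMr // /S; klra.
have Fx : 0 < param_F x.
  apply/param_F_gt0/param_d_le0 => //; rewrite -/S.
  have -> : (2 * k + 1) / x = S by rewrite /x; field; rewrite !gt_eqF.
  by rewrite lerDl ltW // mulr_gt0.
have Fy : 0 < param_F y.
  apply/param_F_gt0/param_d_le0 => //; rewrite -/S.
  have -> : l * y = S by rewrite /y; field; rewrite !gt_eqF.
  by rewrite lerDr ltW // divr_gt0.
have [|b1 /andP[lt_xb1 lt_b11] F1] := @param_F_root x 1 x_gt0 x_lt1.
  by rewrite pmulr_rlt0 // param_F1_lt0.
have [|b2 /andP[lt_1b2 _] F2] := @param_F_root 1 y ltr01 y_gt1.
  by rewrite nmulr_rlt0 // param_F1_lt0.
by exists b1, b2; split => //; exact: lt_trans lt_xb1.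
Qed.

(** These are the hypotheses of [blk_ric_einstein] with a = r b. *)
Lemma param_equations (b : R) : 0 < b -> param_F b = 0 ->
  let r := param_r b in let c := param_c b in let d := param_d b in
  [/\ 0 < d,
      k + k * r ^+ 2 + l * (r * b) ^+ 2 + 1 = c * (r * b),
      l + 2 * k * d ^+ 2 + 1 = c * d,
      2 * k * (2 - r) + l * b ^+ 2 + (2 - r) = c * b &
      k * (2 - r * b) + k * (2 - b) + l * (2 - d) + (4 - r * b - d) / 2 = c].
Proof.
move=> b_gt0 F0; have c_gt0 := param_c_gt0 b_gt0.
have /andP[r_gt0 _] := param_r_bounds b.
have rE : param_r b * (3 * k + 1 + l * b ^+ 2) = k + 1.
  by rewrite /param_r divfK // gt_eqF.
have dE : param_d b * (l + 2^-1) =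
   4 * k + 2 * l + 2 - (k + 2^-1) * (param_r b * b) - k * b - param_c b.
  by rewrite /param_d divfK // gt_eqF; klra.
have cE : param_c b * b = (2 * k + 1) * (2 - param_r b) + l * b ^+ 2.
  by rewrite /param_c; field; rewrite gt_eqF.
move: F0; rewrite /param_F /=.
move: (param_r b) (param_c b) (param_d b) => r c d in r_gt0 c_gt0 rE dE cE *.
move=> F0; split.
(* F = 0 says c d = 2k d^2 + l + 1, so positivity of d follows from that of c. *)
- have : 0 < c * d.
    have : 0 <= 2 * k * d ^+ 2 by apply: sqr_scale_ge0; klra.
    by klra.
  by rewrite pmulr_rgt0.
(* With c b replaced by its value, the right side minus the left side is (1 - r)(r (3k + 1 + l b^2)
   - (k + 1)), which vanishes by the choice of r. *)
- have -> : c * (r * b) = r * (c * b) by ring.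
  rewrite cE; have -> : r * ((2 * k + 1) * (2 - r) + l * b ^+ 2) =
    r * (3 * k + 1 + l * b ^+ 2) + r * (k + 1) - (2 * k + 1) * r ^+ 2 by ring.
  rewrite -[in RHS]rE; klra.
- by klra.
- by rewrite cE; ring.
- by klra.
Qed.

End EinsteinParameters.

(** * Einstein metrics *)

Section ScaledMetric.
Variables (R : realType) (n : nat).
Implicit Types (X Y Z : sp R n).

Definition scaled_metric (lam : 'I_n -> 'I_n -> R) X Y : R :=
  dotf (rescale lam X) Y.

Variable lam : 'I_n -> 'I_n -> R.
Hypothesis lamC : forall p q, lam p q = lam q p.
Hypothesis lam_gt0 : forall p q, 0 < lam p q.

Lemma scaled_metricE X Y : scaled_metric lam X Y =
  \sum_p \sum_q lam p q * qdot (spe p q X) (spe p q Y).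
Proof.
apply: eq_bigr => p _; apply: eq_bigr => q _.
by rewrite spe_rescale // qdotZl.
Qed.

Lemma scaled_metric_inner_product : inner_product (scaled_metric lam).
Proof.
split=> [a X Y Z|X Y|X X_neq0].
- by rewrite /scaled_metric linearP /= dotf_linl.
- rewrite !scaled_metricE; apply: eq_bigr => p _; apply: eq_bigr => q _.
  by rewrite qdotC.
have summand_ge0 p q : 0 <= lam p q * qdot (spe p q X) (spe p q X).
  by rewrite mulr_ge0 ?qdot_ge0 // ltW.
rewrite scaled_metricE lt_neqAle sumr_ge0 ?andbT => [|p _]; last exact: sumr_ge0.
apply: contra X_neq0.
rewrite eq_sym psumr_eq0 => [/allP X0|p _]; last exact: sumr_ge0.
apply/eqP/spe_inj => p q; have := X0 p (mem_index_enum _).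
rewrite psumr_eq0 //= => /allP/(_ q (mem_index_enum _)) /=.
by rewrite mulf_eq0 gt_eqF //= qdot_eq0 linear0 => /eqP.
Qed.

Lemma scaled_metric_einstein c :
  (forall p q, ric lam p q = c * lam p q) ->
  einstein (@sp_br R n) (scaled_metric lam).
Proof.
move=> ricE; have lam_neq0 p q : lam p q != 0 by rewrite gt_eqF.
exists (scaled_nabla lam); split; first exact: levi_civita_scaled.
exists c => Y Z; rewrite scaled_ricci // scaled_metricE mulr_sumr.
apply: eq_bigr => p _; rewrite mulr_sumr; apply: eq_bigr => q _.
by rewrite ricE mulrA.
Qed.

End ScaledMetric.

(** * Weights constant on blocks of sizes k, k and n - 2k *)

Section Blocks.
Variables (R : realType) (n k : nat).
Hypothesis le_2k_n : (k + k <= n)%N.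

Definition blk (p : 'I_n) : nat :=
  if (p < k)%N then 0%N else if (p < k + k)%N then 1%N else 2%N.

Lemma blk_ind (P : nat -> Prop) : P 0%N -> P 1%N -> P 2%N -> forall p, P (blk p).
Proof. by rewrite /blk => P0 P1 P2 p; do 2?case: ifP. Qed.

Lemma sum_blk (F : nat -> R) :
  \sum_p F (blk p) = k%:R * F 0%N + k%:R * F 1%N + (n - (k + k))%:R * F 2%N.
Proof.
pose G p := F (if (p < k)%N then 0%N else if (p < k + k)%N then 1%N else 2%N).
have le_k2k : (k <= k + k)%N by exact: leq_addr.
rewrite -(big_mkord xpredT G) (big_cat_nat (leq0n k) (leq_trans le_k2k le_2k_n)).
rewrite (big_cat_nat le_k2k le_2k_n) /= addrA.
congr (_ + _ + _).
- rewrite (eq_big_nat _ _ (F2 := fun=> F 0%N)); last first.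
    by move=> p /andP[_ lt_pk]; rewrite /G lt_pk.
  by rewrite sumr_const_nat subn0 mulr_natl.
- rewrite (eq_big_nat _ _ (F2 := fun=> F 1%N)); last first.
    by move=> p /andP[le_kp lt_pk]; rewrite /G lt_pk ltnNge le_kp.
  by rewrite sumr_const_nat addnK mulr_natl.
- rewrite (eq_big_nat _ _ (F2 := fun=> F 2%N)); last first.
    move=> p /andP[le_kp _]; rewrite /G !ltnNge le_kp.
    by rewrite (leq_trans (leq_addr _ _) le_kp).
  by rewrite sumr_const_nat mulr_natl.
Qed.

Variables a b d : R.

Definition blk_weight (x y : nat) : R :=
  if x == 2%N then (if y == 2%N then d else 1)
  else if y == 2%N then 1 else if x == y then a else b.

Definition blk_lam (p q : 'I_n) : R := blk_weight (blk p) (blk q).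

Lemma blk_lamC p q : blk_lam p q = blk_lam q p.
Proof.
rewrite /blk_lam /blk_weight [blk p == blk q]eq_sym.
by case: (blk p == 2%N); case: (blk q == 2%N).
Qed.

Lemma blk_lam_gt0 : 0 < a -> 0 < b -> 0 < d -> forall p q, 0 < blk_lam p q.
Proof.
move=> a_gt0 b_gt0 d_gt0 p q; rewrite /blk_lam /blk_weight.
by do !case: ifP.
Qed.

(** [ric] depends only on the blocks of p and q, and [sum_blk] evaluates its sum. The nine pairs of
    blocks then give only the four listed equations, by the symmetry between the first two
    blocks. *)
Lemma blk_ric_einstein c : 0 < a -> 0 < b -> 0 < d ->
  let K : R := k%:R in let L : R := (n - (k + k))%:R in
  K + K * (a / b) ^+ 2 + L * a ^+ 2 + 1 = c * a ->
  L + 2 * K * d ^+ 2 + 1 = c * d ->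
  2 * K * (2 - a / b) + L * b ^+ 2 + (2 - a / b) = c * b ->
  K * (2 - a) + K * (2 - b) + L * (2 - d) + (4 - a - d) / 2 = c ->
  forall p q, ric blk_lam p q = c * blk_lam p q.
Proof.
move=> a_gt0 b_gt0 d_gt0 K L eq11 eq33 eq12 eq13 p q.
have [a_neq0 b_neq0 d_neq0] : [/\ a != 0, b != 0 & d != 0] by rewrite !gt_eqF.
pose al x y z : R := 1 + (blk_weight y z - blk_weight x y) / blk_weight x z.
rewrite /ric.
rewrite (sum_blk (fun s => al s (blk p) (blk q) * al s (blk q) (blk p))).
rewrite /alpha /blk_lam -!/(al _ _ _) -/K -/L.
elim/blk_ind: (blk p); elim/blk_ind: (blk q); rewrite /al /blk_weight /=.
all: rewrite -?eq11 -?eq33 -?eq12 -?eq13.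
all: field; rewrite ?a_neq0 ?b_neq0 ?d_neq0 //.
Qed.

End Blocks.

(** * Natural reductivity *)

Section QuatLimits.
Variables (R : realType) (T : Type) (F : set_system T).
Context {FF : ProperFilter F}.

(** Convergence is componentwise because [quat] is given no topology. *)
Definition quat_cvg (f : T -> quat R) (x : quat R) : Prop :=
  [/\ q0 (f t) @[t --> F] --> q0 x, q1 (f t) @[t --> F] --> q1 x,
      q2 (f t) @[t --> F] --> q2 x & q3 (f t) @[t --> F] --> q3 x].

Lemma quat_cvg_cst x : quat_cvg (fun=> x) x.
Proof. by split; exact: cvg_cst. Qed.

Lemma quat_cvgD f g x y : quat_cvg f x -> quat_cvg g y ->
  quat_cvg (fun t => f t + g t) (x + y).
Proof. by move=> [? ? ? ?] [? ? ? ?]; split; exact: cvgD. Qed.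

Lemma quat_cvgZ (a : T -> R) f (b : R) x : a t @[t --> F] --> b -> quat_cvg f x ->
  quat_cvg (fun t => a t *: f t) (b *: x).
Proof. by move=> ? [? ? ? ?]; split; exact: cvgM. Qed.

Lemma quat_cvg_conj f x : quat_cvg f x -> quat_cvg (fun t => qconj (f t)) (qconj x).
Proof.
have qconjE (y : quat R) : qconj y = Quat (q0 y) (- q1 y) (- q2 y) (- q3 y).
  by case: y.
move=> [f0 f1 f2 f3]; split; rewrite qconjE; under eq_cvg do rewrite qconjE.
all: by [|exact: cvgN].
Qed.

Lemma quat_cvgM f g x y : quat_cvg f x -> quat_cvg g y ->
  quat_cvg (fun t => f t * g t) (x * y).
Proof.
have mulE (u v : quat R) : u * v = Quat
  (q0 u * q0 v - q1 u * q1 v - q2 u * q2 v - q3 u * q3 v)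
  (q0 u * q1 v + q1 u * q0 v + q2 u * q3 v - q3 u * q2 v)
  (q0 u * q2 v - q1 u * q3 v + q2 u * q0 v + q3 u * q1 v)
  (q0 u * q3 v + q1 u * q2 v - q2 u * q1 v + q3 u * q0 v).
  by case: u v => [????] [????]; rewrite quat_mulE.
move=> [f0 f1 f2 f3] [g0 g1 g2 g3]; split; rewrite mulE;
  under eq_cvg do rewrite mulE.
- by apply: cvgB; [apply: cvgB; [apply: cvgB|]|]; apply: cvgM.
- by apply: cvgB; [apply: cvgD; [apply: cvgD|]|]; apply: cvgM.
- by apply: cvgD; [apply: cvgD; [apply: cvgB|]|]; apply: cvgM.
- by apply: cvgD; [apply: cvgB; [apply: cvgD|]|]; apply: cvgM.
Qed.

Lemma cvg_sum (I : finType) (f : I -> T -> R) (x : I -> R) :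
  (forall i, f i t @[t --> F] --> x i) ->
  \sum_i f i t @[t --> F] --> \sum_i x i.
Proof. by move=> fx; apply: (cvg_big add_continuous). Qed.

Lemma quat_cvg_near f g x : {near F, f =1 g} ->
  quat_cvg f x -> quat_cvg g x.
Proof.
move=> fg [f0 f1 f2 f3]; split; [move: f0|move: f1|move: f2|move: f3];
  apply: cvg_trans; apply: near_eq_cvg; near=> t; congr (_ _).
all: by near: t.
Unshelve. all: by end_near. Qed.

Lemma quat_cvg_sum (I : finType) (f : I -> T -> quat R) (x : I -> quat R) :
  (forall i, quat_cvg (f i) (x i)) ->
  quat_cvg (fun t => \sum_i f i t) (\sum_i x i).
Proof.
move=> fx; split; rewrite quat_sum; under eq_cvg do rewrite quat_sum.
all: by apply: cvg_sum => i; case: (fx i).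
Qed.

Lemma cvg_qdot f g x y : quat_cvg f x -> quat_cvg g y ->
  qdot (f t) (g t) @[t --> F] --> qdot x y.
Proof. by move=> /quat_cvg_conj fx gy; have [] := quat_cvgM fx gy. Qed.

End QuatLimits.

(** * Infinitesimal form of Ad(K)-invariance *)

Section NaturallyReductive.
Variables (R : realType) (n : nat).
Implicit Types (X Y Z : sp R n) (A : qmx R n) (lam : 'I_n -> 'I_n -> R).

Definition ip_skew (ip : sp R n -> sp R n -> R) Z : Prop :=
  forall X Y, ip (sp_br Z X) Y + ip X (sp_br Z Y) = 0.

Lemma quat_cvg_ent (T : Type) (F : set_system T) (f : T -> qmx R n) A p q :
  ProperFilter F -> f @ F --> A -> quat_cvg F (fun t => ent p q (f t)) (ent p q A).
Proof.
move=> FF; case: A => [[[A0 A1] A2] A3] fA.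
have f012 : (f t).1 @[t --> F] --> (A0, A1, A2).
  by apply: (@cvg_comp _ _ _ f fst F _ _ fA); exact: cvg_fst.
have f01 : (f t).1.1 @[t --> F] --> (A0, A1).
  by apply: (@cvg_comp _ _ _ (fun t => (f t).1) fst F _ _ f012); exact: cvg_fst.
have f0 : (f t).1.1.1 @[t --> F] --> A0.
  by apply: (@cvg_comp _ _ _ (fun t => (f t).1.1) fst F _ _ f01); exact: cvg_fst.
have f1 : (f t).1.1.2 @[t --> F] --> A1.
  by apply: (@cvg_comp _ _ _ (fun t => (f t).1.1) snd F _ _ f01); exact: cvg_snd.
have f2 : (f t).1.2 @[t --> F] --> A2.
  by apply: (@cvg_comp _ _ _ (fun t => (f t).1) snd F _ _ f012); exact: cvg_snd.
have f3 : (f t).2 @[t --> F] --> A3.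
  by apply: (@cvg_comp _ _ _ f snd F _ _ fA); exact: cvg_snd.
have coord_cvg (g : T -> 'M[R]_n) (B : 'M[R]_n) :
    g t @[t --> F] --> B -> (g t : 'M[R]_n) p q @[t --> F] --> B p q.
  move=> gB; exact: (@cvg_comp _ _ _ g (fun M : 'M[R]_n => M p q) F _ _ gB
    (@coord_continuous _ _ _ p q B)).
by split; apply: coord_cvg.
Qed.

Lemma qmulDl A B C : qmul (A + B) C = qmul A C + qmul B C.
Proof.
apply: ent_inj => p q; rewrite linearD /= !ent_qmul -big_split.
by apply: eq_bigr => r _; rewrite linearD mulrDl.
Qed.

Lemma qmulDr A B C : qmul A (B + C) = qmul A B + qmul A C.
Proof.
apply: ent_inj => p q; rewrite linearD /= !ent_qmul -big_split.
by apply: eq_bigr => r _; rewrite linearD mulrDr.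
Qed.

Lemma qmulZl a A B : qmul (a *: A) B = a *: qmul A B.
Proof.
apply: ent_inj => p q; rewrite linearZ /= !ent_qmul scaler_sumr.
by apply: eq_bigr => r _; rewrite linearZ scalerAl.
Qed.

Lemma qmulZr a A B : qmul A (a *: B) = a *: qmul A B.
Proof.
apply: ent_inj => p q; rewrite linearZ /= !ent_qmul scaler_sumr.
by apply: eq_bigr => r _; rewrite linearZ scalerAr.
Qed.

Lemma qmul1l A : qmul (qid R n) A = A.
Proof.
apply: ent_inj => p q; rewrite ent_qmul (bigD1 p) //= ent_qid eqxx mul1r.
rewrite big1 ?addr0 // => r; rewrite ent_qid eq_sym => /negPf->.
by rewrite mul0r.
Qed.

Lemma qmul1r A : qmul A (qid R n) = A.
Proof.
apply: ent_inj => p q; rewrite ent_qmul (bigD1 q) //= ent_qid eqxx mulr1.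
by rewrite big1 ?addr0 // => r; rewrite ent_qid => /negPf->; rewrite mulr0.
Qed.

Lemma qadj_qidD t A : qadj (qid R n + t *: A) = qid R n + t *: qadj A.
Proof.
apply: ent_inj => p q; rewrite ent_qadj !linearD !linearZ /= !ent_qid ent_qadj.
rewrite [q == p]eq_sym; congr (_ + _).
by case: (p == q); rewrite ?linear0 //; congr Quat; rewrite oppr0.
Qed.

Variable lam : 'I_n -> 'I_n -> R.
Hypothesis lamC : forall p q, lam p q = lam q p.
Hypothesis lam_gt0 : forall p q, 0 < lam p q.
Local Notation ip := (scaled_metric lam).

Lemma cvg_scaled_metric (T : Type) (F : set_system T) (f g : T -> sp R n) X Y :
  ProperFilter F ->
  (forall p q, quat_cvg F (fun t => spe p q (f t)) (spe p q X)) ->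
  (forall p q, quat_cvg F (fun t => spe p q (g t)) (spe p q Y)) ->
  ip (f t) (g t) @[t --> F] --> ip X Y.
Proof.
move=> FF fX gY; rewrite scaled_metricE //.
under eq_cvg do rewrite scaled_metricE //.
apply: cvg_sum => p; apply: cvg_sum => q.
by apply: cvgM; [exact: cvg_cst|exact: cvg_qdot].
Qed.

(** The identity <Ad(phi t) X, Ad(phi t) Y> = <X, Y> is differentiated at t = 0, where the quotient
    [D t V] tends to [Z, V]. *)
Lemma lie_alg_skew (K : set (qmx R n)) Z :
  (forall A X Y, K A -> ip (sp_Ad A X) (sp_Ad A Y) = ip X Y) ->
  lie_alg K Z -> ip_skew ip Z.
Proof.
move=> K_inv [phi [_ Kphi phi_cvg]] X Y.
pose W t := t^-1 *: (phi t - qid R n).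
pose D t V := t^-1 *: (sp_Ad (phi t) V - V).
have phiE t : t != 0 -> phi t = qid R n + t *: W t.
  by move=> t_neq0; rewrite /W scalerA mulfV // scale1r addrC subrK.
(* Substituting phi t = 1 + t W makes the difference quotient explicit, with a quadratic remainder
   that disappears in the limit. *)
have DE t V : t != 0 -> vsval (D t V) = qmul (W t) (vsval V) +
    qmul (vsval V) (qadj (W t)) + t *: qmul (qmul (W t) (vsval V)) (qadj (W t)).
  move=> t_neq0; have := phiE t t_neq0; rewrite /D; move: (W t) => w.
  rewrite linearZ linearB /= vsval_sp_Ad => ->.
  rewrite qadj_qidD qmulDl qmul1l qmulZl qmulDr qmul1r qmulZr !qmulDl !qmulZl.
  rewrite addrC !addrA addNr add0r -!scalerDr scalerA mulVf // scale1r.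
  by rewrite addrA.
have nbhs_neq0 : \forall t \near (0 : R)^', t != 0 by exact: nbhs_dnbhs_neq.
have t_cvg0 : t @[t --> (0 : R)^'] --> (0 : R).
  by apply: cvg_within_filter; exact: cvg_id.
have W_cvg p q : quat_cvg ((0 : R)^') (fun t => ent p q (W t)) (spe p q Z).
  exact: quat_cvg_ent phi_cvg.
have D_cvg V p q : quat_cvg ((0 : R)^') (fun t => spe p q (D t V))
    (spe p q (sp_br Z V)).
  apply: (quat_cvg_near (f := fun t => ent p q (qmul (W t) (vsval V) +
    qmul (vsval V) (qadj (W t)) + t *: qmul (qmul (W t) (vsval V)) (qadj (W t))))).
    by near=> t; rewrite [RHS]/spe DE //; near: t.
  have -> : spe p q (sp_br Z V) = ent p q (qmul (vsval Z) (vsval V) +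
      qmul (vsval V) (qadj (vsval Z)) +
      (0 : R) *: qmul (qmul (vsval Z) (vsval V)) (qadj (vsval Z))).
    by rewrite scale0r addr0 sp_adj qmulNr /spe vsval_sp_br.
  have mul_cvg (f g : R -> qmx R n) A B :
      (forall p q, quat_cvg ((0 : R)^') (fun t => ent p q (f t)) (ent p q A)) ->
      (forall p q, quat_cvg ((0 : R)^') (fun t => ent p q (g t)) (ent p q B)) ->
      forall p q, quat_cvg ((0 : R)^') (fun t => ent p q (qmul (f t) (g t)))
        (ent p q (qmul A B)).
    move=> fA gB p' q'; rewrite ent_qmul.
    rewrite (_ : (fun t => _) =
      fun t => \sum_r ent p' r (f t) * ent r q' (g t)); last first.
      by apply/funext => t; rewrite ent_qmul.
    by apply: quat_cvg_sum => r; exact: quat_cvgM.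
  have adj_cvg p' q' : quat_cvg ((0 : R)^') (fun t => ent p' q' (qadj (W t)))
      (ent p' q' (qadj (vsval Z))).
    rewrite ent_qadj (_ : (fun t => _) = fun t => qconj (ent q' p' (W t))).
      exact: quat_cvg_conj.
    by apply/funext => t; rewrite ent_qadj.
  rewrite !linearD linearZ /=.
  rewrite (_ : (fun t => _) = fun t => ent p q (qmul (W t) (vsval V)) +
    ent p q (qmul (vsval V) (qadj (W t))) +
    t *: ent p q (qmul (qmul (W t) (vsval V)) (qadj (W t)))); last first.
    by apply/funext => t; rewrite !linearD linearZ.
  apply: quat_cvgD; first apply: quat_cvgD.
  - by apply: mul_cvg => // ? ?; exact: quat_cvg_cst.
  - by apply: mul_cvg => // ? ?; exact: quat_cvg_cst.
  - apply: quat_cvgZ => //; apply: (mul_cvg) => //.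
    by apply: mul_cvg => // ? ?; exact: quat_cvg_cst.
have AdE t V : t != 0 -> sp_Ad (phi t) V = t *: D t V + V.
  by move=> t_neq0; rewrite /D scalerA mulfV // scale1r subrK.
have Ad_cvg V p q : quat_cvg ((0 : R)^') (fun t => spe p q (sp_Ad (phi t) V))
    (spe p q V).
  apply: (quat_cvg_near (f := fun t => t *: spe p q (D t V) + spe p q V)).
    by near=> t; rewrite AdE ?linearP //; near: t.
  rewrite -[spe p q V in X in quat_cvg _ _ X]add0r -(scale0r (spe p q (sp_br Z V))).
  by apply: quat_cvgD; [exact: quat_cvgZ|exact: quat_cvg_cst].
have [ip_lin ipC _] := scaled_metric_inner_product lamC lam_gt0.
have lim_ip : ip (D t X) (sp_Ad (phi t) Y) + ip X (D t Y) @[t --> (0 : R)^'] -->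
    ip (sp_br Z X) Y + ip X (sp_br Z Y).
  apply: cvgD; apply: cvg_scaled_metric => // p q; exact: quat_cvg_cst.
(* For t != 0, t times this expression is <Ad X, Ad Y> - <X, Y> = 0. *)
have lim_0 : ip (D t X) (sp_Ad (phi t) Y) + ip X (D t Y) @[t --> (0 : R)^'] -->
    (0 : R).
  have zero_cvg : (fun=> 0 : R) t @[t --> (0 : R)^'] --> (0 : R).
    exact: cvg_cst.
  apply: cvg_trans zero_cvg; apply: near_eq_cvg; near=> t.
  have t_neq0 : t != 0 by near: t.
  apply: (mulfI t_neq0); rewrite mulr0 mulrDr.
  have := K_inv (phi t) X Y (Kphi t).
  rewrite {1}(AdE t X) // ip_lin.
  have -> : ip X (sp_Ad (phi t) Y) = t * ip X (D t Y) + ip X Y.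
    by rewrite AdE // ipC ip_lin ipC [ip Y X]ipC.
  by lra.
rewrite -(cvg_lim (@norm_hausdorff _ _) lim_ip).
by rewrite (cvg_lim (@norm_hausdorff _ _) lim_0).
Unshelve. all: by end_near. Qed.

End NaturallyReductive.

(** * Skew elements and the geodesic condition *)

Section SkewElements.
Variables (R : realType) (n : nat) (lam : 'I_n -> 'I_n -> R).
Hypothesis lamC : forall p q, lam p q = lam q p.
Hypothesis lam_gt0 : forall p q, 0 < lam p q.
Implicit Types (X Y Z : sp R n) (p q s t : 'I_n).
Local Notation ip := (scaled_metric lam).

Let dotfBl X Y Z : dotf (X - Y) Z = dotf X Z - dotf Y Z.
Proof. by rewrite addrC -scaleN1r dotf_linl mulN1r addrC. Qed.

Lemma dotf_rescale X Y : dotf (rescale lam X) Y = dotf X (rescale lam Y).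
Proof.
apply: eq_bigr => p _; apply: eq_bigr => q _.
by rewrite !spe_rescale // qdotZl qdotZr.
Qed.

(** As [dotf] is ad-invariant and nondegenerate, ad Z is skew for <lam X, Y> exactly when it
    commutes with the operator lam. *)
Lemma ip_skewP Z : ip_skew ip Z <->
  forall X, rescale lam (sp_br Z X) = sp_br Z (rescale lam X).
Proof.
have ip_skewE X Y : ip (sp_br Z X) Y + ip X (sp_br Z Y) =
    dotf (rescale lam (sp_br Z X) - sp_br Z (rescale lam X)) Y.
  rewrite /scaled_metric dotfBl; congr (_ + _).
  by rewrite dotf_inv opprK.
split=> [Z_skew X|Z_comm X Y]; last first.
  by rewrite ip_skewE Z_comm dotfBl subrr.
apply/eqP; rewrite -subr_eq0; apply/eqP/dotf_nondeg => Y.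
by rewrite -ip_skewE.
Qed.

(** Lift X and Y to (X - W, -W) and (Y - Z, -Z) in the complement, and put the lift of Y in the last
    two places of the reductivity identity: <[X, Y - Z] - [W, Y], Y> = 0. The W term vanishes
    because ad W is skew, and X is arbitrary. *)
Lemma naturally_reductive_geodesic : naturally_reductive ip ->
  forall Y, exists2 Z, ip_skew ip Z & sp_br (Y - Z) (rescale lam Y) = 0.
Proof.
move=> [K [[_ K1 _ _ _] [K_inv [P [_ K_split _ P_skew]]]]] Y.
have [ip_lin ipC _] := scaled_metric_inner_product lamC lam_gt0.
have lie0 : lie_alg K 0.
  exists (fun=> qid R n); split => [s t|t|]; first by rewrite qmul1l.
    exact: K1.
  under eq_cvg do rewrite subrr scaler0.
  have -> : vsval (0 : sp R n) = 0 :> qmx R n by exact: linear0.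
  exact: cvg_cst.
(* (X, 0) is projected along the diagonal of k, which [orbit_diff] kills; the result is therefore a
   lift of X. *)
have horizontal X : exists2 Z, lie_alg K Z & (X - Z, - Z) \in P.
  have [Z [[lieZ ZP] _]] := K_split X 0 lie0.
  by exists Z => //; rewrite sub0r in ZP.
have [Z lieZ YZ_P] := horizontal Y.
have Z_skew : ip_skew ip Z := lie_alg_skew lamC lam_gt0 K_inv lieZ.
exists Z => //; rewrite sp_brC; apply/eqP; rewrite oppr_eq0; apply/eqP.
apply: dotf_nondeg => X.
have [W lieW XW_P] := horizontal X.
have W_skew : ip_skew ip W := lie_alg_skew lamC lam_gt0 K_inv lieW.
have := P_skew _ _ _ XW_P YZ_P YZ_P; rewrite /orbit_diff /pair_br /=.
have -> : Y - Z - - Z = Y by rewrite opprK subrK.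
have -> : sp_br (X - W) (Y - Z) - sp_br (- W) (- Z) =
    sp_br X (Y - Z) - sp_br W Y.
  rewrite sp_brBl [sp_br W _]sp_brBr sp_brNl sp_brNr opprK opprB.
  by rewrite addrA addrAC addrK.
have Wskew0 : ip (sp_br W Y) Y = 0.
  by have := W_skew Y Y; rewrite [ip Y _]ipC; lra.
rewrite [ip Y _]ipC /scaled_metric linearB dotfBl -!/(ip _ _) Wskew0 subr0.
have -> : ip (sp_br X (Y - Z)) Y = - dotf (sp_br (rescale lam Y) (Y - Z)) X.
  rewrite /scaled_metric dotf_rescale sp_brC -sp_brNl dotf_inv sp_brNl -sp_brC.
  by rewrite dotfC.
by lra.
Qed.

(** The unit i rather than 1, because for s = t the skew-Hermitian part of the real unit is zero. *)
Definition imag_unit : 'I_4 := Ordinal (isT : (1 < 4)%N).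

(* Tested on the matrix with [i] in the entries (s, t) and (t, s), at the entry
   (p, t). *)
Lemma ip_skew_entry0 Z p s t : ip_skew ip Z -> p != s -> p != t ->
  lam p t != lam s t -> spe p s Z = 0.
Proof.
move=> /ip_skewP Z_comm neq_ps neq_pt neq_lam.
set U := @skewpart R n (eunit R s t imag_unit).
have row0 r : spe p r U = 0.
  rewrite spe_eunit (negPf neq_ps) (negPf neq_pt) andbF /= !mulr0n subr0.
  by rewrite scaler0.
have brE mu : (forall p q, mu p q = mu q p) ->
    spe p t (sp_br Z (rescale mu U)) = \sum_r mu r t *: (spe p r Z * spe r t U).
  move=> muC; rewrite spe_br; apply: eq_bigr => r _.
  by rewrite !spe_rescale // row0 scaler0 mul0r subr0 -scalerAr.
have := congr1 (spe p t) (Z_comm U).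
(* Rescaling by 1 brings both sides into the form of [brE]. *)
have -> : sp_br Z U = sp_br Z (rescale (fun _ _ => 1) U).
  congr sp_br; apply: spe_inj => p' q'; by rewrite spe_rescale // scale1r.
rewrite spe_rescale // !brE //.
rewrite !(col_eunit_sum s t imag_unit (fun r => _ r t) (fun r => spe p r Z)).
have conjI : qconj (qunit imag_unit) = - qunit imag_unit :> quat R.
  by rewrite /qunit /qI; congr Quat; rewrite oppr0.
rewrite eqxx !mulr1n scale1r conjI !mulrN => E.
have : (lam p t - lam s t) *: (spe p s Z * qunit imag_unit) = 0.
  apply: qdot_inj => u; move: (congr1 (qdot u) E).
  case: (eqVneq t s) => [->|_]; rewrite ?mulr1n ?mulr0n;
    rewrite !(qdotZr, qdotBr, qdotNr) linear0; lra.
move/eqP; rewrite scaler_eq0 subr_eq0 (negPf neq_lam) /= => /eqP ZI0.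
have II : qunit imag_unit * - qunit imag_unit = 1 :> quat R.
  by rewrite -conjI /qunit /qI quat_mulE; congr Quat; ring.
by rewrite -[LHS]mulr1 -II mulrA ZI0 mul0r.
Qed.

End SkewElements.

(** * Block metrics are not naturally reductive *)

Section BlockMetrics.
Variables (R : realType) (n k : nat).
Hypotheses (k_gt0 : (0 < k)%N) (lt_2k_n : (k + k < n)%N).
Implicit Types (X Y Z : sp R n) (p q s t : 'I_n).

Let lt_0_n : (0 < n)%N. Proof. exact: leq_ltn_trans (leq0n _) lt_2k_n. Qed.
Let lt_k_n : (k < n)%N. Proof. exact: leq_ltn_trans (leq_addr _ _) lt_2k_n. Qed.
Let e0 : 'I_n := Ordinal lt_0_n.
Let e1 : 'I_n := Ordinal lt_k_n.
Let e2 : 'I_n := Ordinal lt_2k_n.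

Let blk_e0 : blk k e0 = 0%N. Proof. by rewrite /blk /= k_gt0. Qed.
Let blk_e1 : blk k e1 = 1%N.
Proof. by rewrite /blk /= ltnn -{1}[k]addn0 ltn_add2l k_gt0. Qed.
Let blk_e2 : blk k e2 = 2%N.
Proof. by rewrite /blk /= ltnn ltnNge leq_addr. Qed.

Variables a b d : R.
Hypotheses (a_gt0 : 0 < a) (b_gt0 : 0 < b) (d_gt0 : 0 < d).
Hypotheses (neq_ab : a != b) (neq_b1 : b != 1).
Local Notation lam := (@blk_lam R n k a b d).
Local Notation ip := (scaled_metric lam).

Let lamC := blk_lamC (n := n) k a b d.
Let lam_gt0 := @blk_lam_gt0 R n k a b d a_gt0 b_gt0 d_gt0.

(** Given p and s in different blocks, [ip_skew_entry0] needs t with different weights. If p or s is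
    in the third block, a t in the one of the first two blocks that misses both opposes b to 1;
    otherwise t = s opposes b to a. Conversely, a block diagonal Z links only indices with the same
    weights. *)
Lemma ip_skew_blkP Z :
  ip_skew ip Z <-> (forall p s, blk k p != blk k s -> spe p s Z = 0).
Proof.
split=> [Z_skew p s neq_blk|Z_blk].
  have neqP p' q' : blk k p' != blk k q' -> p' != q'.
    by apply: contraNneq => ->.
  have entry0 := ip_skew_entry0 lamC Z_skew.
  have [t neq_pt neq_lam] : exists2 t, p != t & lam p t != lam s t; last first.
    exact: (entry0 p s t (neqP _ _ neq_blk)).
  have := neq_blk; have := neqP p s neq_blk; rewrite /blk_lam.
  have e0P : blk k p != 0%N -> p != e0 by rewrite -blk_e0; exact: neqP.
  have e1P : blk k p != 1%N -> p != e1 by rewrite -blk_e1; exact: neqP.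
  have : exists2 t, p != t & blk_weight a b d (blk k p) (blk k t) !=
      blk_weight a b d (blk k s) (blk k t).
    case: (eqVneq (blk k p) 2%N) neq_blk => [bp|bp].
      rewrite bp => neq_2s.
      case: (eqVneq (blk k s) 0%N) => bs.
        exists e1; first by rewrite e1P // bp.
        by rewrite bs blk_e1 /blk_weight /= eq_sym.
      exists e0; first by rewrite e0P // bp.
      rewrite blk_e0 /blk_weight /= [blk k s == 2%N]eq_sym (negPf neq_2s).
      by rewrite (negPf bs) eq_sym.
    case: (eqVneq (blk k s) 2%N) => [bs _|bs neq_ps].
      case: (eqVneq (blk k p) 0%N) => bp0.
        exists e1; first by rewrite e1P // bp0.
        by rewrite bs bp0 blk_e1.
      exists e0; first by rewrite e0P.
      by rewrite bs blk_e0 /blk_weight /= (negPf bp) (negPf bp0).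
    exists s; first exact: neqP.
    by rewrite /blk_weight (negPf bp) (negPf bs) (negPf neq_ps) eqxx eq_sym.
  by [].
apply: (proj2 (ip_skewP _ Z)) => X; apply: spe_inj => p q.
rewrite spe_rescale // !spe_br scaler_sumr; apply: eq_bigr => r _.
rewrite !spe_rescale // scalerBr -!scalerAr -!scalerAl.
have block_l : lam p q *: (spe p r Z * spe r q X) =
    lam r q *: (spe p r Z * spe r q X).
  case: (eqVneq (blk k p) (blk k r)) => [e|/Z_blk->]; first by rewrite /blk_lam e.
  by rewrite mul0r !scaler0.
have block_r : lam p q *: (spe p r X * spe r q Z) =
    lam p r *: (spe p r X * spe r q Z).
  case: (eqVneq (blk k r) (blk k q)) => [e|/Z_blk->]; first by rewrite /blk_lam e.
  by rewrite mulr0 !scaler0.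
by rewrite block_l block_r.
Qed.

Lemma blk_metric_not_naturally_reductive : ~ naturally_reductive ip.
Proof.
move=> /(naturally_reductive_geodesic lamC lam_gt0) geodesic.
pose one : 'I_4 := ord0.
pose Y : sp R n := skewpart (eunit R e0 e1 one) + skewpart (eunit R e1 e2 one).
have [Z /ip_skew_blkP Z_blk /(congr1 (spe e0 e2))] := geodesic Y.
have neqP p q : blk k p != blk k q -> (p == q) = false.
  by move=> neq; apply/negbTE; apply: contraNneq neq => ->.
have n01 : (e0 == e1) = false by rewrite neqP // blk_e0 blk_e1.
have n02 : (e0 == e2) = false by rewrite neqP // blk_e0 blk_e2.
have n12 : (e1 == e2) = false by rewrite neqP // blk_e1 blk_e2.
have oneE : qunit one = 1 :> quat R by [].
have Yrow r : spe e0 r Y = 2^-1 *: 1 *+ ((r == e1) && true).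
  rewrite linearD /= !spe_eunit oneE eqxx n01 n02.
  by rewrite !(andbF, andbT, andFb, andTb, mulr0n, subr0, scaler0, addr0) scalerMnr.
have Ycol r : spe r e2 Y = 2^-1 *: 1 *+ ((r == e1) && true).
  rewrite linearD /= !spe_eunit oneE eqxx [e2 == e1]eq_sym [e2 == e0]eq_sym n12 n02.
  by rewrite !(andbF, andbT, andFb, andTb, mulr0n, subr0, scaler0, add0r) scalerMnr.
(* Only r = e1 contributes, and Z has no entry at (e0, e1) or (e1, e2). What remains is (1 - b)/4 =
   0. *)
rewrite linear0 spe_br.
under eq_bigr => r _ do rewrite !spe_rescale // Yrow Ycol.
rewrite (bigD1 e1) //= big1 ?addr0 => [|r /negPf->]; last first.
  by rewrite !mulr0n !scaler0 mulr0 mul0r subr0.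
rewrite !linearB /= Yrow Ycol !Z_blk ?blk_e0 ?blk_e1 ?blk_e2 // eqxx !subr0.
have -> : lam e1 e2 = 1 by rewrite /blk_lam blk_e1 blk_e2.
have -> : lam e0 e1 = b by rewrite /blk_lam blk_e0 blk_e1.
move/(congr1 (@qre R)); rewrite /= !mulr1n -!scalerAl -!scalerAr mulr1.
rewrite qreB !qreZ (_ : qre 0 = 0); last by rewrite linear0.
rewrite (_ : qre 1 = 1) // => E; move/eqP: neq_b1; apply; lra.
Qed.

End BlockMetrics.

(** * Inequivalence *)

Section Inequivalence.
Variables (R : realType) (n : nat).
Implicit Types (X Y Z : sp R n) (p q s t : 'I_n) (mu : 'I_n -> 'I_n -> R).

(** For symmetric [mu] this weighs real dimensions: 4 for each pair s < t, and 2 + 1 = 3 for each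
    imaginary diagonal entry. *)
Lemma endo_trace_rescale mu :
  endo_trace (rescale mu) = 2 * (\sum_s \sum_t mu s t) + \sum_s mu s s.
Proof.
rewrite (@endo_trace_skew _ _ (fun X p q => mu p q *: spe p q X)) => [|s t];
  last first.
  by move=> a X Y; rewrite linearP /= scalerDr !scalerA mulrC.
transitivity (\sum_s \sum_t (2 * mu s t + (mu s s) *+ ((t == s) && true))).
  apply: eq_bigr => s _; apply: eq_bigr => t _.
  under eq_bigr => a _ do rewrite spe_eunit !eqxx /= mulr1n !qdotZr qdotBr qdotMnr.
  rewrite -!mulr_sumr sumrB sumrMnl.
  have := qunit_mulr (1 : quat R); under eq_bigr => a _ do rewrite mulr1.
  move=> ->.
  have := qunit_conj_mulr (1 : quat R); under eq_bigr => a _ do rewrite mulr1.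
  move=> ->; rewrite (_ : qre 1 = 1) // [s == t]eq_sym andbb andbT.
  by case: (eqVneq t s) => [->|_]; rewrite ?mulr1n ?mulr0n; field.
under eq_bigr do rewrite big_split /= sum_delta mulr1n -mulr_sumr.
by rewrite big_split /= -mulr_sumr.
Qed.

Section Isomorphism.
Variable f : {linear sp R n -> sp R n}.
Hypothesis f_bij : bijective f.
Hypothesis f_br : forall X Y, f (sp_br X Y) = sp_br (f X) (f Y).

(** An automorphism preserves the Killing form. With all weights 1 the connection is half the
    bracket, so [trace_scaled_nabla2] identifies that form with a multiple of [dotf]. *)
Lemma dotf_iso X Y : dotf (f X) (f Y) = dotf X Y.
Proof.
pose one (p q : 'I_n) : R := 1.
have oneC p q : one p q = one q p by [].
have one_neq0 p q : one p q != 0 by exact: oner_neq0.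
have rescale1 mu Z : mu = one -> rescale mu Z = Z.
  by move=> ->; apply: spe_inj => p q; rewrite spe_rescale // scale1r.
have nablaE U V : scaled_nabla one U V = 2^-1 *: sp_br U V.
  rewrite /scaled_nabla /koszul /= !rescale1 ?subrr ?addr0 //.
  by apply/funext => p; apply/funext => q; rewrite /one invr1.
have f_nabla U V : f (scaled_nabla one U V) = scaled_nabla one (f U) (f V).
  by rewrite !nablaE linearZ /= f_br.
have killingE U V :
    endo_trace (fun Z => scaled_nabla one (scaled_nabla one Z U) V) =
    - ((n%:R + 1) * dotf U V).
  rewrite trace_scaled_nabla2 //; congr (- _); rewrite mulr_sumr.
  apply: eq_bigr => r _; rewrite mulr_sumr; apply: eq_bigr => t _.
  congr (_ * _); rewrite /ric /alpha /one subrr mul0r addr0 !mulr1.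
  by rewrite sumr_const card_ord; lra.
have lin U V : linear (fun Z => scaled_nabla one (scaled_nabla one Z U) V).
  by move=> a Z W; rewrite !scaled_nabla_linl.
pose g1 : {linear sp R n -> sp R n} :=
  HB.pack (fun Z => scaled_nabla one (scaled_nabla one Z X) Y)
    (GRing.isLinear.Build R (sp R n) (sp R n) *:%R _ (lin X Y)).
pose g2 : {linear sp R n -> sp R n} :=
  HB.pack (fun Z => scaled_nabla one (scaled_nabla one Z (f X)) (f Y))
    (GRing.isLinear.Build R (sp R n) (sp R n) *:%R _ (lin (f X) (f Y))).
have g_conj Z : g2 (f Z) = f (g1 Z).
  by rewrite [RHS]f_nabla f_nabla.
have E := endo_trace_conj f_bij g_conj.
have {}E : - ((n%:R + 1) * dotf X Y) = - ((n%:R + 1) * dotf (f X) (f Y)).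
  exact: etrans (esym (killingE X Y)) (etrans E (killingE (f X) (f Y))).
have n1_neq0 : n%:R + 1 != 0 :> R by rewrite natr1 pnatr_eq0.
by apply: (mulfI n1_neq0); apply: oppr_inj.
Qed.

Variables (lam1 lam2 : 'I_n -> 'I_n -> R) (c : R).
Hypothesis c_gt0 : 0 < c.
Hypothesis f_metric : forall X Y,
  scaled_metric lam2 (f X) (f Y) = c * scaled_metric lam1 X Y.

(** Since [f] is a [dotf]-isometry, the relation between the metrics passes to their operators: [f]
    maps an eigenvector of lam1 for e to one of lam2 for c e. *)
Lemma rescale_iso X : rescale lam2 (f X) = c *: f (rescale lam1 X).
Proof.
have [fi fK fiK] := f_bij.
apply/eqP; rewrite -subr_eq0; apply/eqP/dotf_nondeg => Y.
rewrite -[Y]fiK addrC -scaleN1r scalerA dotf_linl dotf_iso.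
have := f_metric X (fi Y); rewrite /scaled_metric => ->.
by rewrite mulN1r mulNr addNr.
Qed.

Lemma ip_skew_iso Z :
  ip_skew (scaled_metric lam1) Z <-> ip_skew (scaled_metric lam2) (f Z).
Proof.
have [fi fK fiK] := f_bij; split=> [Z_skew X Y|fZ_skew X Y].
  rewrite -[X]fiK -[Y]fiK -!f_br !f_metric -mulrDr.
  by rewrite Z_skew mulr0.
have c_neq0 : c != 0 by rewrite gt_eqF.
by apply: (mulfI c_neq0); rewrite mulr0 mulrDr -!f_metric !f_br.
Qed.

End Isomorphism.

(** For symmetric [m], [rescale] with these 0/1 weights projects onto the entries selected by
    [m]. *)
Definition blk_mask (k : nat) (m : nat -> nat -> bool) p q : R :=
  (m (blk k p) (blk k q))%:R.

Definition same_blk (x y : nat) := x == y.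
Definition off_blk12 (x y : nat) := [&& x != y, x != 2%N & y != 2%N].
Definition off_blk3 (x y : nat) := (x != y) && ((x == 2%N) || (y == 2%N)).

Lemma trace_blk_mask k (m : nat -> nat -> bool) : (k + k <= n)%N ->
  endo_trace (rescale (blk_mask k m)) =
  let w x : R := if x is 2%N then (n - (k + k))%:R else k%:R in
  2 * (w 0%N * (w 0%N * (m 0 0)%N%:R + w 1%N * (m 0 1)%N%:R + w 2%N * (m 0 2)%N%:R) +
       w 1%N * (w 0%N * (m 1 0)%N%:R + w 1%N * (m 1 1)%N%:R + w 2%N * (m 1 2)%N%:R) +
       w 2%N * (w 0%N * (m 2 0)%N%:R + w 1%N * (m 2 1)%N%:R + w 2%N * (m 2 2)%N%:R)) +
  (w 0%N * (m 0 0)%N%:R + w 1%N * (m 1 1)%N%:R + w 2%N * (m 2 2)%N%:R).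
Proof.
move=> le_2k_n; rewrite endo_trace_rescale /blk_mask.
rewrite (sum_blk le_2k_n (fun x => (m x x)%:R)).
rewrite (sum_blk le_2k_n (fun x => \sum_t (m x (blk k t))%:R)).
by rewrite !(sum_blk le_2k_n (fun y => (m _ y)%:R)).
Qed.

Lemma same_blkC k p q : blk_mask k same_blk p q = blk_mask k same_blk q p.
Proof. by rewrite /blk_mask /same_blk eq_sym. Qed.

Lemma off_blk12C k p q : blk_mask k off_blk12 p q = blk_mask k off_blk12 q p.
Proof. by rewrite /blk_mask /off_blk12 eq_sym [_ && (_ != 2%N)]andbC. Qed.

Lemma off_blk3C k p q : blk_mask k off_blk3 p q = blk_mask k off_blk3 q p.
Proof. by rewrite /blk_mask /off_blk3 eq_sym orbC. Qed.

End Inequivalence.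

Lemma double_lt_of_triple n k : (3 * k < n)%N -> (k + k < n)%N.
Proof. lia. Qed.

Lemma lt_sub_of_triple n k : (3 * k < n)%N -> (k < n - (k + k))%N.
Proof. lia. Qed.

(** * Equivalent metrics have the same block size *)

Section BlockInequivalence.
Variables (R : realType) (n k1 k2 : nat).
Hypotheses (k1_gt0 : (0 < k1)%N) (k2_gt0 : (0 < k2)%N).
Hypotheses (lt_3k1_n : (3 * k1 < n)%N) (lt_3k2_n : (3 * k2 < n)%N).
Variables (a1 b1 d1 a2 b2 d2 : R).
Hypotheses (a2_gt0 : 0 < a2) (b2_gt0 : 0 < b2) (d2_gt0 : 0 < d2).
Hypotheses (neq_a1b1 : a1 != b1) (neq_b11 : b1 != 1).
Hypotheses (neq_a2b2 : a2 != b2) (neq_b21 : b2 != 1).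
Implicit Types (X Y Z : sp R n) (p q s t : 'I_n).

Local Notation lam1 := (@blk_lam R n k1 a1 b1 d1).
Local Notation lam2 := (@blk_lam R n k2 a2 b2 d2).

Let lt_2k1_n := double_lt_of_triple lt_3k1_n.
Let lt_2k2_n := double_lt_of_triple lt_3k2_n.
Let lam1C := blk_lamC (n := n) k1 a1 b1 d1.
Let lam2C := blk_lamC (n := n) k2 a2 b2 d2.
Let lam2_gt0 := @blk_lam_gt0 R n k2 a2 b2 d2 a2_gt0 b2_gt0 d2_gt0.

Variables (f : {linear sp R n -> sp R n}) (c : R).
Hypothesis f_bij : bijective f.
Hypothesis f_br : forall X Y, f (sp_br X Y) = sp_br (f X) (f Y).
Hypothesis c_gt0 : 0 < c.
Hypothesis f_metric : forall X Y,
  scaled_metric lam2 (f X) (f Y) = c * scaled_metric lam1 X Y.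

Local Notation proj k m := (rescale (@blk_mask R n k m)).

Let spe_same k X p q : spe p q (proj k same_blk X) =
  (blk k p == blk k q)%:R *: spe p q X.
Proof. by rewrite spe_rescale //; exact: same_blkC. Qed.

(** The range of the projection is the space of skew elements, which [f] preserves, and its kernel
    is orthogonal to that space; so [f] preserves the kernels too. *)
Lemma same_blk_iso X : proj k2 same_blk (f X) = f (proj k1 same_blk X).
Proof.
have [fi fK fiK] := f_bij.
have skew1 Z : ip_skew (scaled_metric lam1) (proj k1 same_blk Z).
  apply/ip_skew_blkP => // p s neq; by rewrite spe_same (negPf neq) scale0r.
have skew_fixed Z : ip_skew (scaled_metric lam2) Z -> proj k2 same_blk Z = Z.
  move=> /ip_skew_blkP Z_blk; apply: spe_inj => p q; rewrite spe_same.
  by case: (eqVneq (blk k2 p) (blk k2 q)) => [_|/Z_blk->];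
    rewrite ?scale1r ?scaler0.
pose V := X - proj k1 same_blk X.
have V_orth Z : ip_skew (scaled_metric lam1) Z -> scaled_metric lam1 V Z = 0.
  move=> /ip_skew_blkP Z_blk; rewrite scaled_metricE //.
  apply: big1 => p _; apply: big1 => q _; rewrite linearB /= spe_same.
  case: (eqVneq (blk k1 p) (blk k1 q)) => [_|/Z_blk->//].
    by rewrite scale1r subrr qdotC linear0 mulr0.
  by rewrite linear0 mulr0.
(* The block diagonal part of [f V] is the image of a skew element, to which V is orthogonal; hence
   its norm is zero. *)
have projV : proj k2 same_blk (f V) = 0.
  have skew2 : ip_skew (scaled_metric lam2) (proj k2 same_blk (f V)).
    apply/ip_skew_blkP => // p s neq; by rewrite spe_same (negPf neq) scale0r.
  have skew2' : ip_skew (scaled_metric lam1) (fi (proj k2 same_blk (f V))).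
    by apply/(ip_skew_iso f_bij f_br c_gt0 f_metric); rewrite fiK.
  have [_ _ pos2] := scaled_metric_inner_product lam2C lam2_gt0.
  apply/eqP; apply: contraT => /pos2.
  have -> : scaled_metric lam2 (proj k2 same_blk (f V)) (proj k2 same_blk (f V)) =
      scaled_metric lam2 (f V) (f (fi (proj k2 same_blk (f V)))).
    rewrite fiK !scaled_metricE //; apply: eq_bigr => p _; apply: eq_bigr => q _.
    rewrite !spe_same; case: (blk k2 p == blk k2 q); rewrite ?scale1r //.
    by rewrite scale0r !linear0.
  by rewrite f_metric V_orth // mulr0 ltxx.
have XE : X = V + proj k1 same_blk X by rewrite subrK.
have fE : f X = f V + f (proj k1 same_blk X) by rewrite {1}XE; exact: (linearD f).
have projD A B : proj k2 same_blk (A + B) =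
    proj k2 same_blk A + proj k2 same_blk B by exact: linearD.
rewrite fE projD projV add0r; apply: skew_fixed.
exact: (proj1 (ip_skew_iso f_bij f_br c_gt0 f_metric (proj k1 same_blk X))).
Qed.

Lemma block_size_eq : k1 = k2.
Proof.
have := endo_trace_conj f_bij same_blk_iso.
rewrite !trace_blk_mask ?(ltnW lt_2k1_n) ?(ltnW lt_2k2_n) //=.
rewrite !natrB ?(ltnW lt_2k1_n) ?(ltnW lt_2k2_n) // !natrD !mulr1 !mulr0.
have : 3 * k1%:R < n%:R :> R by rewrite -natrM ltr_nat.
have : 3 * k2%:R < n%:R :> R by rewrite -natrM ltr_nat.
move=> lt2 lt1 E; apply/eqP; rewrite -(eqr_nat R) -subr_eq0.
(* The block diagonal matrices have dimension 2(6k^2 - 4nk + n^2) + n. The last factor is positive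
   because 3 k1 < n and 3 k2 < n. *)
have : (k1%:R - k2%:R) * (2 * n%:R - 3 * k1%:R - 3 * k2%:R) = 0 :> R by nra.
move/eqP; rewrite mulf_eq0 => /orP[//|/eqP]; lra.
Qed.

End BlockInequivalence.

(** * Equivalent metrics with the same blocks have the same b *)

Section SameBlocks.
Variables (R : realType) (n k : nat).
Hypotheses (k_gt0 : (0 < k)%N) (lt_3k_n : (3 * k < n)%N).
Variables (a1 b1 d1 a2 b2 d2 : R).
Hypotheses (a2_gt0 : 0 < a2) (b2_gt0 : 0 < b2) (d2_gt0 : 0 < d2).
Hypotheses (neq_a1b1 : a1 != b1) (neq_b11 : b1 != 1).
Hypotheses (neq_a2b2 : a2 != b2) (neq_b21 : b2 != 1).
Implicit Types (X Y Z : sp R n) (p q s t : 'I_n).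

Local Notation lam1 := (@blk_lam R n k a1 b1 d1).
Local Notation lam2 := (@blk_lam R n k a2 b2 d2).

Variables (f : {linear sp R n -> sp R n}) (c : R).
Hypothesis f_bij : bijective f.
Hypothesis f_br : forall X Y, f (sp_br X Y) = sp_br (f X) (f Y).
Hypothesis c_gt0 : 0 < c.
Hypothesis f_metric : forall X Y,
  scaled_metric lam2 (f X) (f Y) = c * scaled_metric lam1 X Y.

Local Notation projP := (rescale (@blk_mask R n k same_blk)).
Local Notation projQ := (rescale (@blk_mask R n k off_blk12)).
Local Notation projM := (rescale (@blk_mask R n k off_blk3)).

Let f0 : f 0 = 0. Proof. exact: linear0. Qed.

Let fZ a X : f (a *: X) = a *: f X. Proof. exact: linearZ. Qed.

Let speZ p q a X : spe p q (a *: X) = a *: spe p q X. Proof. exact: linearZ. Qed.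

Let f_eq0 X : f X = 0 -> X = 0.
Proof. by move=> fX0; apply: (bij_inj f_bij); rewrite fX0 f0. Qed.

Let le_2k_n := ltnW (double_lt_of_triple lt_3k_n).

Let spe_mask m X p q : (forall p q, @blk_mask R n k m p q = blk_mask R k m q p) ->
  spe p q (rescale (blk_mask R k m) X) = (m (blk k p) (blk k q))%:R *: spe p q X.
Proof. exact: spe_rescale. Qed.

Let speP X p q : spe p q (projP X) = (same_blk (blk k p) (blk k q))%:R *: spe p q X.
Proof. by rewrite spe_mask //; exact: same_blkC. Qed.
Let speQ X p q : spe p q (projQ X) = (off_blk12 (blk k p) (blk k q))%:R *: spe p q X.
Proof. by rewrite spe_mask //; exact: off_blk12C. Qed.
Let speM X p q : spe p q (projM X) = (off_blk3 (blk k p) (blk k q))%:R *: spe p q X.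
Proof. by rewrite spe_mask //; exact: off_blk3C. Qed.

Let fP X : projP (f X) = f (projP X).
Proof.
exact: (same_blk_iso k_gt0 k_gt0 lt_3k_n lt_3k_n
  a2_gt0 b2_gt0 d2_gt0 neq_a1b1 neq_b11 neq_a2b2 neq_b21 f_bij f_br c_gt0 f_metric).
Qed.

Let maskP p q : [\/ [/\ same_blk (blk k p) (blk k q),
      off_blk12 (blk k p) (blk k q) = false & off_blk3 (blk k p) (blk k q) = false],
    [/\ same_blk (blk k p) (blk k q) = false, off_blk12 (blk k p) (blk k q),
      off_blk3 (blk k p) (blk k q) = false & lam2 p q = b2] |
    [/\ same_blk (blk k p) (blk k q) = false, off_blk12 (blk k p) (blk k q) = false,
      off_blk3 (blk k p) (blk k q) & lam2 p q = 1]].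
Proof.
rewrite /blk_lam /same_blk /off_blk12 /off_blk3.
elim/blk_ind: (blk k p); elim/blk_ind: (blk k q) => /=;
  by [constructor 1|constructor 2|constructor 3].
Qed.

Let lam1Q X : rescale lam1 (projQ X) = b1 *: projQ X.
Proof.
apply: spe_inj => p q; rewrite spe_rescale; last exact: blk_lamC.
rewrite speZ speQ /blk_lam /off_blk12.
elim/blk_ind: (blk k p); elim/blk_ind: (blk k q) => /=;
  by rewrite ?scale0r ?scaler0.
Qed.

Let lam1M X : rescale lam1 (projM X) = projM X.
Proof.
apply: spe_inj => p q; rewrite spe_rescale; last exact: blk_lamC.
rewrite speM /blk_lam /off_blk3.
elim/blk_ind: (blk k p); elim/blk_ind: (blk k q) => /=;
  by rewrite ?scale0r ?scaler0 ?scale1r.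
Qed.

Let f_same X p q : projP X = 0 -> same_blk (blk k p) (blk k q) -> spe p q (f X) = 0.
Proof.
move=> PX0 pq; have := congr1 (spe p q) (fP X).
by rewrite PX0 f0 speP pq scale1r linear0.
Qed.

Let PQ0 X : projP (projQ X) = 0.
Proof.
apply: spe_inj => p q; rewrite speP speQ linear0.
by case: (maskP p q) => [[_ -> _]|[-> _ _ _]|[-> _ _ _]]; rewrite !scale0r ?scaler0.
Qed.

Let PM0 X : projP (projM X) = 0.
Proof.
apply: spe_inj => p q; rewrite speP speM linear0.
by case: (maskP p q) => [[_ _ ->]|[-> _ _ _]|[-> _ _ _]]; rewrite !scale0r ?scaler0.
Qed.

Let spe_eigen X e p q : rescale lam1 X = e *: X -> lam2 p q != c * e ->
  spe p q (f X) = 0.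
Proof.
move=> X_eig neq; have := congr1 (spe p q) (rescale_iso f_bij f_br f_metric X).
rewrite X_eig spe_rescale; last exact: blk_lamC.
rewrite fZ scalerA speZ => /eqP.
rewrite -subr_eq0 -scalerBl scaler_eq0 subr_eq0 (negPf neq) /=.
by move/eqP.
Qed.

Let spe_fQ X p q : lam2 p q != c * b1 -> spe p q (f (projQ X)) = 0.
Proof. exact: spe_eigen. Qed.

Let spe_fM X p q : lam2 p q != c -> spe p q (f (projM X)) = 0.
Proof.
by rewrite -{1}[c]mulr1; apply: spe_eigen; rewrite lam1M scale1r.
Qed.

Let trace_eq0 mu : (forall X, rescale mu X = 0 :> sp R n) ->
  endo_trace (g := sp R n) (rescale mu) = 0.
Proof.
by move=> mu0; rewrite /endo_trace big1 // => i _; rewrite mu0 linear0.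
Qed.

Let K_gt0 : 0 < k%:R :> R. Proof. by rewrite ltr0n. Qed.
Let L_gtK : k%:R < (n - (k + k))%:R :> R. Proof. by rewrite ltr_nat lt_sub_of_triple. Qed.

Let traceQ : endo_trace projQ = 4 * k%:R ^+ 2.
Proof. by rewrite trace_blk_mask //= /off_blk12 /=; ring. Qed.

Let traceM : endo_trace projM = 8 * (k%:R * (n - (k + k))%:R).
Proof. by rewrite trace_blk_mask //= /off_blk3 /=; ring. Qed.

(** Off the diagonal blocks, [f] takes the eigenvalues b1 and 1 to c b1 and c, which must be among
    b2 and 1. If b1 != b2, then c = 1 leaves no place for b1, and c outside 1 and b2 leaves none for
    c. If c = b2, the entries meeting the third block would go onto those between the first two, but
    8k(n - 2k) > 4k^2. *)
Lemma off_weight_eq : b1 = b2.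
Proof.
have K2_gt0 : 0 < k%:R ^+ 2 :> R by rewrite exprn_gt0.
have KL_gt : k%:R ^+ 2 < k%:R * (n - (k + k))%:R :> R by rewrite ltr_pM2l.
have traceQ_neq0 : endo_trace projQ != 0 by rewrite traceQ gt_eqF //; lra.
have traceM_neq0 : endo_trace projM != 0 by rewrite traceM gt_eqF //; lra.
case: (eqVneq b1 b2) => // neq_b12.
have [c1|c_neq1] := eqVneq c 1.
  case/negP: traceQ_neq0; apply/eqP/trace_eq0 => X; apply: f_eq0.
  apply: spe_inj => p q; rewrite linear0.
  case: (maskP p q) => [[same _ _]|[_ _ _ e]|[_ _ _ e]].
  - by rewrite f_same.
  - by rewrite spe_fQ // e c1 mul1r eq_sym.
  - by rewrite spe_fQ // e c1 mul1r eq_sym.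
have [cb|c_neqb] := eqVneq c b2; last first.
  case/negP: traceM_neq0; apply/eqP/trace_eq0 => X; apply: f_eq0.
  apply: spe_inj => p q; rewrite linear0.
  case: (maskP p q) => [[same _ _]|[_ _ _ e]|[_ _ _ e]].
  - by rewrite f_same.
  - by rewrite spe_fM // e eq_sym.
  - by rewrite spe_fM // e eq_sym.
have swap X : projQ (f X) = f (projM X).
  have XE : X = projP X + projQ X + projM X.
    apply: spe_inj => p q; rewrite !(linearD (spe p q)) /= speP speQ speM.
    case: (maskP p q) => [[-> -> ->]|[-> -> -> _]|[-> -> -> _]];
      by rewrite !scale0r !scale1r ?addr0 ?add0r.
  have fE : f X = f (projP X) + f (projQ X) + f (projM X).
    by rewrite {1}XE (linearD f) /= (linearD f).
  apply: spe_inj => p q; rewrite speQ.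
  case: (maskP p q) => [[same -> _]|[diff -> _ e]|[_ -> _ e]].
  - by rewrite scale0r f_same.
  - rewrite fE scale1r !(linearD (spe p q)) /= -fP speP diff scale0r add0r.
    have b2_neq0 : b2 != 0 by rewrite gt_eqF.
    (* The weight here is b2 = c, which differs from c b1 because b1 != 1. *)
    rewrite spe_fQ ?add0r // e cb -{1}[b2]mulr1 (inj_eq (mulfI b2_neq0)).
    by rewrite eq_sym.
  - by rewrite scale0r spe_fM // e eq_sym.
have := endo_trace_conj f_bij swap; rewrite traceQ traceM; lra.
Qed.

End SameBlocks.

Lemma blk_metrics_inequivalent (R : realType) (n k1 k2 : nat)
    (a1 b1 d1 a2 b2 d2 : R) :
  (0 < k1)%N -> (0 < k2)%N -> (3 * k1 < n)%N -> (3 * k2 < n)%N ->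
  0 < a2 -> 0 < b2 -> 0 < d2 ->
  a1 != b1 -> b1 != 1 -> a2 != b2 -> b2 != 1 ->
  equivalent_metrics (@sp_br R n)
    (scaled_metric (@blk_lam R n k1 a1 b1 d1))
    (scaled_metric (@blk_lam R n k2 a2 b2 d2)) ->
  k1 = k2 /\ b1 = b2.
Proof.
move=> k1_gt0 k2_gt0 lt1 lt2 a2_gt0 b2_gt0 d2_gt0.
move=> neq_ab1 neq_b11 neq_ab2 neq_b21 [f [c [f_bij f_br c_gt0 f_metric]]].
have eq_k : k1 = k2.
  exact: (block_size_eq k1_gt0 k2_gt0 lt1 lt2
    a2_gt0 b2_gt0 d2_gt0 neq_ab1 neq_b11 neq_ab2 neq_b21 f_bij f_br c_gt0 f_metric).
split=> //; rewrite -eq_k in f_metric.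
exact: (off_weight_eq k1_gt0 lt1
    a2_gt0 b2_gt0 d2_gt0 neq_ab1 neq_b11 neq_ab2 neq_b21 f_bij f_br c_gt0 f_metric).
Qed.

(** * Two metrics for each block size k with 3k < n *)

Theorem theorem1p6 (R : realType) (n : nat) (hn : (4 <= n)%N) :
  exists m : 'I_(2 * ((n - 1) %/ 3))%N -> sp R n -> sp R n -> R,
    (forall i, [/\ inner_product (m i),
                   einstein (@sp_br R n) (m i) &
                   ~ naturally_reductive (m i)]) /\
    (forall i j, i <> j -> ~ equivalent_metrics (@sp_br R n) (m i) (m j)).
Proof.
(* The quotient of i by 2 encodes the block size, from 1 to (n - 1) %/ 3, and its parity encodes the
   side of 1 on which the root b is taken. *)
set N := (2 * _)%N; pose k (i : 'I_N) := (i %/ 2).+1.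
pose K i : R := (k i)%:R; pose L i : R := (n - (k i + k i))%:R.
have lt_3k_n i : (3 * k i < n)%N.
  by have := ltn_ord i; rewrite /k /N; lia.
have k_gt0 i : (0 < k i)%N by [].
have K_ge1 i : 1 <= K i by rewrite /K ler1n.
have lt_KL i : K i + 1 <= L i.
  by rewrite /K /L natr1 ler_nat lt_sub_of_triple.
have weightP (i : 'I_N) : exists b : R, [/\ 0 < b, b != 1, (1 < b) = odd i &
    param_F (K i) (L i) b = 0].
  have [b1 [b2 [b1_gt0 b1_lt1 b2_gt1 F1 F2]]] := param_F_roots (K_ge1 i) (lt_KL i).
  case: (odd i).
    exists b2; split=> //; first exact: lt_trans b2_gt1.
    by rewrite gt_eqF.
  exists b1; split=> //; first by rewrite lt_eqF.
  by apply/negbTE; rewrite -leNgt ltW.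
have [b bP] := choice weightP.
pose r i := param_r (K i) (L i) (b i).
pose d i := param_d (K i) (L i) (b i).
have b_gt0 i : 0 < b i by case: (bP i).
have b_neq1 i : b i != 1 by case: (bP i).
have F0 i : param_F (K i) (L i) (b i) = 0 by case: (bP i).
have r_bounds i : 0 < r i < 1 := param_r_bounds (K_ge1 i) (lt_KL i) (b i).
have a_gt0 i : 0 < r i * b i by case/andP: (r_bounds i) => *; rewrite mulr_gt0.
have d_gt0 i : 0 < d i.
  by case: (param_equations (K_ge1 i) (lt_KL i) (b_gt0 i) (F0 i)).
have neq_ab i : r i * b i != b i.
  by case/andP: (r_bounds i) => _ lt_r1; rewrite lt_eqF // gtr_pMl.
pose lam i := @blk_lam R n (k i) (r i * b i) (b i) (d i).
exists (fun i => scaled_metric (lam i)); split=> [i|i j neq_ij].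
  have lamC : forall p q, lam i p q = lam i q p := blk_lamC (k i) _ _ _.
  have lam_gt0 : forall p q, 0 < lam i p q.
    exact: blk_lam_gt0 (a_gt0 i) (b_gt0 i) (d_gt0 i).
  have lt_2k_n := double_lt_of_triple (lt_3k_n i).
  split; first exact: scaled_metric_inner_product.
    apply: (scaled_metric_einstein lamC lam_gt0 (c := param_c (K i) (L i) (b i))).
    have [_ eq11 eq33 eq12 eq13] :=
      param_equations (K_ge1 i) (lt_KL i) (b_gt0 i) (F0 i).
    by apply: (blk_ric_einstein (ltnW lt_2k_n)) => //=;
      rewrite ?mulfK ?gt_eqF.
  exact: blk_metric_not_naturally_reductive.
move=> /(blk_metrics_inequivalent (k_gt0 i) (k_gt0 j) (lt_3k_n i) (lt_3k_n j)
  (a_gt0 j) (b_gt0 j) (d_gt0 j) (neq_ab i) (b_neq1 i)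
  (neq_ab j) (b_neq1 j)) [[eq_k] eq_b].
apply: neq_ij; apply/val_inj.
(* The parity of the index is recovered from b as [1 < b], its half from the block size. *)
rewrite /= -[LHS]odd_double_half -[RHS]odd_double_half.
have [[_ _ <- _] [_ _ <- _]] := (bP i, bP j).
by rewrite eq_b -!divn2 eq_k.
Qed.
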